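(* Let $\lambda\in\mathcal M$ and $\mu$ be nonzero finite Borel measures on $S^{n-1}$ not concentrated on any closed hemisphere, and let $\Theta=(G,\Psi,\lambda)$. Suppose either (a) $\Psi\in\mathcal C_d$ with $\lim_{t\to0^+}\Psi(\xi,t)=+\infty$ for each $\xi\in S^{n-1}$, and $G\in\mathscr G_d$; or (b) $G\in\mathcal C_d$ with $\lim_{t\to0^+}G(\xi,t)=+\infty$ for each $\xi\in S^{n-1}$, and $\Psi\in\mathscr G_d$. Then there exists $K\in\mathscr K^n_{(o)}$ with $\frac{\mu}{|\mu|}=\frac{C_\Theta(K,\cdot)}{C_\Theta(K,S^{n-1})}$.
   Context: $S^{n-1}$ unit sphere of $\mathbb R^n$, $n\ge2$, $d\xi$ spherical Lebesgue measure, $|\mu|=\mu(S^{n-1})$. $\mathscr K^n_{(o)}$: compact convex sets with the origin in their interior. For $K\in\mathscr K^n_{(o)}$: $\rho_K(x)=\max\{t\ge0:tx\in K\}$, $K^*=\{x:x\cdot y\le1\ \forall y\in K\}$; $\pmb\alpha_K(\xi)$ is the set of outer unit normals at $\rho_K(\xi)\xi$, a singleton $\{\alpha_K(\xi)\}$ for a.e. $\xi$; $\pmb\alpha^*_K(\omega)=\{\xi:\pmb\alpha_K(\xi)\cap\omega\ne\emptyset\}$. $\mathcal C$: $G:S^{n-1}\times(0,\infty)\to\mathbb R$ with $G$, $G_t$ continuous; $\mathcal C_d=\{G\in\mathcal C:G_t<0\}$. $\mathscr G_d$: $G\in\mathcal C$ with values in $(0,\infty)$ such that for each $u$: $G_t(u,\cdot)<0$,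 $\lim_{t\to0^+}G(u,t)=\infty$, $\lim_{t\to\infty}G(u,t)=0$. $\mathcal M$: nonzero finite Borel measures absolutely continuous w.r.t. $d\xi$. $C_\Theta(K,\omega)=\int_{\pmb\alpha^*_K(\omega)}\frac{\rho_K(\xi)G_t(\xi,\rho_K(\xi))}{\rho_{K^*}(\alpha_K(\xi))\Psi_t(\alpha_K(\xi),\rho_{K^*}(\alpha_K(\xi)))}d\lambda(\xi)$. $\mu$ is not concentrated on any closed hemisphere if $\int(u\cdot\xi)_+d\mu(\xi)>0$ for all $u\in S^{n-1}$. *)

(* Defs.v *)
From HB Require Import structures.
From mathcomp Require Import all_boot all_order all_algebra.
From mathcomp Require Import all_classical all_reals all_analysis.
Set Implicit Arguments.
Unset Strict Implicit.
Unset Printing Implicit Defensive.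
Import Order.TTheory GRing.Theory Num.Theory.
Import numFieldTopology.Exports numFieldNormedType.Exports.
Local Open Scope ring_scope.
Local Open Scope classical_set_scope.

Section Defs.
Variables (R : realType) (n : nat).
Local Notation V := 'rV[R]_n.

Definition dotv (x y : V) : R := \sum_(i < n) x ord0 i * y ord0 i.

Definition sphere : set V := [set x | dotv x x = 1].

Definition Rn := g_sigma_algebraType (@open V).

Definition leb_null (A : set V) : Prop :=
  forall eps : R, 0 < eps ->
  exists a b : nat -> V,
    (forall k i, a k ord0 i <= b k ord0 i) /\
    (forall x, A x -> exists k, forall i, a k ord0 i <= x ord0 i <= b k ord0 i) /\
    (\sum_(k <oo) ((\prod_(i < n) (b k ord0 i - a k ord0 i))%:E) < eps%:E)%E.

(** null sets of spherical Lebesgue measure d xi: A (subset of the sphere)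
    is null iff the cone {t x : x in A, 0 < t <= 1} is Lebesgue-null
    (d xi(A) = n * vol(cone A)) *)
Definition sph_null (A : set V) : Prop :=
  leb_null [set y | exists t x, 0 < t <= 1 /\ A x /\ y = t *: x].

Definition sph_measure (mu : {measure set Rn -> \bar R}) : Prop :=
  (mu (~` sphere) = 0)%E /\ (0 < mu setT)%E /\ (mu setT < +oo)%E.

Definition classM (lam : {measure set Rn -> \bar R}) : Prop :=
  sph_measure lam /\
  forall A : set Rn, measurable A -> A `<=` sphere -> sph_null A -> lam A = 0%E.

Definition not_conc_hemisphere (mu : {measure set Rn -> \bar R}) : Prop :=
  forall u : V, sphere u ->
    (0 < \int[mu]_(xi in (sphere : set Rn)) (Num.max (dotv u xi) 0)%:E)%E.

Definition convex_set (K : set V) : Prop :=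
  forall x y (t : R), K x -> K y -> 0 <= t <= 1 -> K (t *: x + (1 - t) *: y).

Definition convex_body_o (K : set V) : Prop :=
  convex_set K /\ compact K /\ (interior K) 0.

Definition radial (K : set V) (x : V) : R := sup [set t | 0 <= t /\ K (t *: x)].

Definition polar (K : set V) : set V := [set x | forall y, K y -> dotv x y <= 1].

Definition normals (K : set V) (p : V) : set V :=
  [set u | sphere u /\ forall y, K y -> dotv y u <= dotv p u].

Definition radial_gauss_set (K : set V) (xi : V) : set V :=
  normals K (radial K xi *: xi).

(** alpha_K(xi): the unique normal where it is unique (a.e.); an arbitrary
    element of alpha_K(xi) otherwise *)
Definition radial_gauss (K : set V) (xi : V) : V := xget 0 (radial_gauss_set K xi).

Definition rev_radial_gauss (K : set V) (omega : set V) : set V :=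
  [set xi | sphere xi /\ exists u, radial_gauss_set K xi u /\ omega u].

Definition dt (G : V -> R -> R) (u : V) (t : R) : R := derive1 (G u) t.

Definition sph_dom : set (V * R) := [set p | sphere p.1 /\ 0 < p.2].

Definition classC (G : V -> R -> R) : Prop :=
  (forall u t, sphere u -> 0 < t -> derivable (G u) t 1) /\
  {within sph_dom, continuous (fun p => G p.1 p.2)} /\
  {within sph_dom, continuous (fun p => dt G p.1 p.2)}.

Definition classCd (G : V -> R -> R) : Prop :=
  classC G /\ forall u t, sphere u -> 0 < t -> dt G u t < 0.

Definition classGd (G : V -> R -> R) : Prop :=
  classC G /\
  (forall u t, sphere u -> 0 < t -> 0 < G u t) /\
  (forall u t, sphere u -> 0 < t -> dt G u t < 0) /\
  (forall u, sphere u -> G u t @[t --> 0^'+] --> +oo) /\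
  (forall u, sphere u -> G u t @[t --> +oo] --> 0).

Definition C_Theta (G Psi : V -> R -> R) (lam : {measure set Rn -> \bar R})
    (K : set V) (omega : set V) : \bar R :=
  (\int[lam]_(xi in (rev_radial_gauss K omega : set Rn))
     ((radial K xi * dt G xi (radial K xi)) /
      (radial (polar K) (radial_gauss K xi) *
       dt Psi (radial_gauss K xi) (radial (polar K) (radial_gauss K xi))))%:E)%E.

End Defs.
Arguments sphere {R n}.

(* Main.v *)
Require Import Defs.
From HB Require Import structures.
From mathcomp Require Import all_boot all_order all_algebra.
From mathcomp Require Import all_classical all_reals all_analysis.
From mathcomp Require Import measurable_realfun.
From mathcomp Require Import ring lra.
Set Implicit Arguments.
Unset Strict Implicit.
Unset Printing Implicit Defensive.
Import Order.TTheory GRing.Theory Num.Theory.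
Import numFieldTopology.Exports numFieldNormedType.Exports.
Local Open Scope ring_scope.
Local Open Scope classical_set_scope.

(** A convex body with the origin in its interior is encoded by two positive
    functions: its support function [h] and its gauge [q] (the reciprocal radial
    function), which are exchanged by [polar_fun f x = sup_u (u . x) / f u].
    Put A = int G(xi, 1 / q) dlam and B = int Psi(u, 1 / h) dmu.  Minimising
    max(A, B) over all bodies gives a body for which no other one lowers both A
    and B.  The minimum exists: when A and B are bounded above, the blow-up of G
    and Psi at 0 and the positivity of one of them keep h and q away from 0, hence
    also from infinity, and minimising sequences then converge uniformly on the
    sphere.  Replacing h by the function h / (1 + s g), and q by the polar
    function of the latter, varies q by s q g(alpha_K) to first order wherever the
    normal is unique; so the linear functionals
    g |-> int rho G_t g(alpha_K) dlam and g |-> int rho_* Psi_t g dmu are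
    proportional (rho_* being the radial function of the polar body).  Taking g
    of the form phi / (rho_* Psi_t) this says that C_Theta(K, .) is a positive
    multiple of mu.  Normals are unique almost everywhere because
    x + w |-> x is 1-Lipschitz for boundary points x with a normal w, and
    singular points are reached from countably many flats of codimension 2. *)

(** * The Euclidean inner product *)

(** The two functions are treated asymmetrically because [mu] may have atoms, whereas [lam] charges
    no null set. The support function, integrated against [mu], is perturbed by an explicit formula,
    differentiable in every direction. The gauge, integrated against [lam], only responds through
    its polar function and is differentiable just where the normal is unique. Minimality is tested
    against all pairs with u . xi <= h u * q xi. This inequality survives limits and perturbations,
    exact duality does not, and passing to the bipolar restores duality without raising either
    energy. Since G and Psi decrease in t, both energies increase with h and q, and a dilation
    trades one for the other. No homogeneity is available to normalise the size of the body, so the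
    maximum of the energies lets the minimisation choose it. The price is an unknown multiplier,
    which cancels in mu / |mu|. *)

Section DotProduct.
Context {R : realType} {n : nat}.
Local Notation V := 'rV[R]_n.
Implicit Types x y z u v : V.

Lemma dotvC x y : dotv x y = dotv y x.
Proof. by apply: eq_bigr => i _; rewrite mulrC. Qed.

Lemma dotvDr x y z : dotv x (y + z) = dotv x y + dotv x z.
Proof. by rewrite -big_split; apply: eq_bigr => i _; rewrite mxE mulrDr. Qed.

Lemma dotvZr (a : R) x y : dotv x (a *: y) = a * dotv x y.
Proof. by rewrite [RHS]mulr_sumr; apply: eq_bigr => i _; rewrite mxE mulrCA. Qed.

Lemma dotvNr x y : dotv x (- y) = - dotv x y.
Proof. by rewrite -scaleN1r dotvZr mulN1r. Qed.

Lemma dotvBr x y z : dotv x (y - z) = dotv x y - dotv x z.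
Proof. by rewrite dotvDr dotvNr. Qed.

Lemma dotvDl x y z : dotv (x + y) z = dotv x z + dotv y z.
Proof. by rewrite ![dotv _ z]dotvC dotvDr. Qed.

Lemma dotvBl x y z : dotv (x - y) z = dotv x z - dotv y z.
Proof. by rewrite ![dotv _ z]dotvC dotvBr. Qed.

Lemma dotvZl (a : R) x y : dotv (a *: x) y = a * dotv x y.
Proof. by rewrite ![dotv _ y]dotvC dotvZr. Qed.

Lemma dotvNl x y : dotv (- x) y = - dotv x y.
Proof. by rewrite ![dotv _ y]dotvC dotvNr. Qed.

Lemma dotv_ge0 x : 0 <= dotv x x.
Proof. by apply: sumr_ge0 => i _; rewrite -expr2 sqr_ge0. Qed.

Lemma sqr_coord_le x i : x ord0 i ^+ 2 <= dotv x x.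
Proof.
rewrite /dotv (bigD1 i)//= -expr2 lerDl.
by apply: sumr_ge0 => j _; rewrite -expr2 sqr_ge0.
Qed.

Lemma coord_le_norm x i : `|x ord0 i| <= `|x|.
Proof. by rewrite (_ : `|x| = mx_norm x)// mx_normrE; apply: (le_bigmax _ (fun ij => `|x ij.1 ij.2|) (ord0, i)). Qed.

Lemma norm_le_coord x (c : R) : 0 <= c -> (forall i, `|x ord0 i| <= c) -> `|x| <= c.
Proof.
move=> c0 h; rewrite (_ : `|x| = mx_norm x)// mx_normrE.
by apply/bigmax_leP; split => // -[i j] _ /=; rewrite ord1.
Qed.

Lemma dotv_le1 u v : sphere u -> sphere v -> dotv u v <= 1.
Proof.
rewrite /sphere /= => u1 v1; have := dotv_ge0 (u - v).
by rewrite dotvBr !dotvBl u1 v1 (dotvC v u); lra.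
Qed.

Lemma sphere_coord u i : sphere u -> `|u ord0 i| <= 1.
Proof.
by move=> u1; have := sqr_coord_le u i; rewrite u1 -real_normK ?num_real// expr_le1.
Qed.

(** The norm of ['rV[R]_n] is the maximum norm, not the Euclidean one; this is the source of the
    factors [n%:R] in all Lipschitz constants below. *)
Lemma norm_dotv u x : sphere u -> `|dotv u x| <= n%:R * `|x|.
Proof.
move=> u1; rewrite (le_trans (ler_norm_sum _ _ _))//.
rewrite (@le_trans _ _ (\sum_(i < n) `|x|))//; last first.
  by rewrite sumr_const card_ord mulr_natl.
apply: ler_sum => i _; rewrite normrM.
by rewrite -[leRHS]mul1r ler_pM//; [exact: sphere_coord|exact: coord_le_norm].
Qed.

Lemma continuous_dotv {T : topologicalType} (f g : T -> V) :
  continuous f -> continuous g -> continuous (fun p => dotv (f p) (g p)).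
Proof.
move=> cf cg p; rewrite /dotv; apply: cvg_big.
  exact: add_continuous.
move=> i _; apply: cvgM.
- exact: (continuous_comp (cf p) (@coord_continuous _ _ _ _ _ _)).
- exact: (continuous_comp (cg p) (@coord_continuous _ _ _ _ _ _)).
Qed.

Lemma continuous_dotvr u : continuous (dotv u).
Proof. by apply: continuous_dotv => // x; [exact: cst_continuous|exact: cvg_id]. Qed.

Lemma closed_sphere : closed (sphere : set V).
Proof.
have -> : (sphere : set V) = (fun x => dotv x x) @^-1` [set 1] by [].
apply: preimage_closed; last exact: closed_eq.
by move=> x _; apply: continuous_dotv => // y; exact: cvg_id.
Qed.

Lemma compact_sphere : compact (sphere : set V).
Proof.
apply: bounded_closed_compact; last exact: closed_sphere.
exists 1; split => // M M1 x sx.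
apply: (le_trans _ (ltW M1)); apply: norm_le_coord => // i; exact: sphere_coord.
Qed.

Lemma sphere_neq0 : (0 < n)%N -> (sphere : set V) !=set0.
Proof.
move=> n0; pose i := Ordinal n0; exists (\row_k (k == i)%:R).
rewrite /sphere /= /dotv (bigD1 i)//= !mxE eqxx mulr1 big1 ?addr0// => k /negPf ki.
by rewrite !mxE ki mul0r.
Qed.

End DotProduct.

(** * Polar functions *)

Lemma continuous_withinM {R : realType} {T : topologicalType} (A : set T) (f g : T -> R) :
  {within A, continuous f} -> {within A, continuous g} ->
  {within A, continuous (fun x => f x * g x)}.
Proof. by move=> cf cg x; apply: cvgM; [exact: cf|exact: cg]. Qed.

Lemma continuous_withinV {R : realType} {T : topologicalType} (A : set T) (f : T -> R) :
  {within A, continuous f} -> (forall x, A x -> f x != 0) ->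
  {within A, continuous (fun x => (f x)^-1)}.
Proof.
move=> /subspace_continuousP cf f0; apply/subspace_continuousP => x Ax.
by apply: cvgV; [exact: f0|exact: cf].
Qed.

Lemma lipschitz_continuous {R : realType} {V : normedModType R} (f : V -> R) (k : R) :
  (forall x y, `|f x - f y| <= k * `|x - y|) -> continuous f.
Proof.
move=> fk x; apply/(cvgrPdist_lt (FF := nbhs_filter x)) => d d0.
(* No sign is assumed on [k]; dividing by [|k| + 1] is always possible. *)
have k1 : 0 < `|k| + 1 by rewrite ltr_wpDl.
near=> y; apply: le_lt_trans (fk _ _) _.
apply: (@le_lt_trans _ _ ((`|k| + 1) * `|x - y|)).
  by rewrite ler_wpM2r// (le_trans (ler_norm k))// lerDl.
rewrite mulrC -ltr_pdivlMr//; near: y.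
by apply: (@cvgr_dist_lt _ _ _ _ (nbhs_filter x) id); [exact: cvg_id|exact: divr_gt0].
Unshelve. all: by end_near. Qed.

Section PolarFunction.
Context {R : realType} {n : nat} (n0 : (0 < n)%N).
Local Notation V := 'rV[R]_n.
Implicit Types (u v x y : V) (f g : V -> R).

Definition pos_cont f :=
  {within sphere, continuous f} /\ forall u, sphere u -> 0 < f u.

(** For any positive continuous [f] this is the gauge of the body {y : u . y <= f u for all u}, and
    also the support function of the convex hull of the points u / f u. *)
Definition polar_fun f x : R := sup [set dotv u x / f u | u in (sphere : set V)].

Lemma pos_cont_cst (c : R) : 0 < c -> pos_cont (fun _ => c).
Proof. by move=> c0; split => // x; exact: cvg_cst. Qed.

Lemma pos_contV f : pos_cont f -> pos_cont (fun u => (f u)^-1).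
Proof.
move=> [cf f0]; split; last by move=> u su; rewrite invr_gt0 f0.
by apply: continuous_withinV => // x Ax; rewrite gt_eqF ?f0.
Qed.

Lemma pos_cont_ge f : pos_cont f -> exists2 e : R, 0 < e & forall u, sphere u -> e <= f u.
Proof.
move=> [cf f0].
have [c] := compact_EVT_min (sphere_neq0 n0) compact_sphere cf.
rewrite inE => sc h; exists (f c); first exact: f0.
by move=> u su; apply: h; rewrite inE.
Qed.

Lemma pos_cont_bounds f : pos_cont f ->
  exists2 e : R, 0 < e & forall u, sphere u -> e <= f u <= e^-1.
Proof.
move=> pf; have [a a0 ha] := pos_cont_ge pf; have [b b0 hb] := pos_cont_ge (pos_contV pf).
exists (Num.min a b); first by rewrite lt_min a0.
move=> u su; rewrite ge_min ha//= -[leLHS]invrK lef_pV2 ?posrE ?invr_gt0 ?lt_min ?a0//.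
  by rewrite ge_min hb// orbT.
by case: pf => _; apply.
Qed.

Lemma polar_fun_max f x : pos_cont f ->
  exists2 u, sphere u & polar_fun f x = dotv u x / f u /\
    forall v, sphere v -> dotv v x / f v <= dotv u x / f u.
Proof.
move=> pf.
have cf : {within sphere, continuous (fun u => dotv u x / f u)}.
  apply: continuous_withinM; last by case: (pos_contV pf).
  apply: continuous_subspaceT; apply: continuous_dotv => y; first exact: cvg_id.
  exact: cst_continuous.
have [u] := compact_EVT_max (sphere_neq0 n0) compact_sphere cf.
rewrite inE => su h; exists u => //.
have hu v : sphere v -> dotv v x / f v <= dotv u x / f u.
  by move=> sv; apply: h; rewrite inE.
split => //; apply/eqP; rewrite eq_le; apply/andP; split.
  by apply: ge_sup; [exists (dotv u x / f u), u|move=> _ [v sv <-]; exact: hu].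
apply: ub_le_sup; last by exists u.
by exists (dotv u x / f u) => _ [v sv <-]; exact: hu.
Qed.

Lemma polar_fun_ge f x v : pos_cont f -> sphere v -> dotv v x / f v <= polar_fun f x.
Proof. by move=> /(polar_fun_max x)[u su [-> h]]; exact: h. Qed.

Lemma dotv_le_polar_fun f x v : pos_cont f -> sphere v -> dotv v x <= f v * polar_fun f x.
Proof.
move=> pf sv; have f0 : 0 < f v by case: (pf) => _; apply.
by rewrite mulrC -ler_pdivrMr//; exact: polar_fun_ge.
Qed.

Lemma polar_fun_le f x (c : R) : pos_cont f ->
  (forall v, sphere v -> dotv v x <= c * f v) -> polar_fun f x <= c.
Proof.
move=> pf h; have [u su [-> _]] := polar_fun_max x pf.
by rewrite ler_pdivrMr ?h//; case: pf => _; exact.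
Qed.

(** The constant depends on [f] only through its lower bound [e]. This equicontinuity is what makes
    minimising sequences compact. *)
Lemma polar_fun_lipschitz f (e : R) : pos_cont f -> 0 < e ->
  (forall u, sphere u -> e <= f u) ->
  forall x y, `|polar_fun f x - polar_fun f y| <= n%:R / e * `|x - y|.
Proof.
move=> pf e0 ef.
suff h x y : polar_fun f x - polar_fun f y <= n%:R / e * `|x - y|.
  by move=> x y; rewrite ler_norml h andbT lerNl opprB distrC h.
rewrite lerBlDr; have [u su [-> _]] := polar_fun_max x pf.
have f0 : 0 < f u by exact: lt_le_trans (ef _ su).
rewrite -[x in dotv u x](subrK y) dotvDr mulrDl lerD//; last exact: polar_fun_ge.
rewrite mulrAC; apply: (le_trans (ler_norm _)); rewrite normrM normfV (gtr0_norm f0).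
apply: ler_pM; rewrite ?invr_ge0 ?(ltW f0)//; first exact: norm_dotv.
by rewrite lef_pV2 ?posrE ?ef.
Qed.

Lemma pos_cont_polar_fun f : pos_cont f -> pos_cont (polar_fun f).
Proof.
move=> pf; have [e e0 ef] := pos_cont_ge pf; split; last first.
  move=> u su; apply: lt_le_trans (polar_fun_ge u pf su).
  by rewrite divr_gt0// ?(proj2 pf)//; rewrite su.
apply: continuous_subspaceT.
exact: lipschitz_continuous (polar_fun_lipschitz pf e0 ef).
Qed.

Lemma polar_fun_anti f g : pos_cont f -> pos_cont g ->
  (forall u, sphere u -> f u <= g u) ->
  forall u, sphere u -> polar_fun g u <= polar_fun f u.
Proof.
move=> pf pg fg u su; apply: polar_fun_le => // v sv.
apply: le_trans (dotv_le_polar_fun u pf sv) _.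
rewrite mulrC ler_pM2l ?fg//; by case: (pos_cont_polar_fun pf) => _; apply.
Qed.

Lemma polar_funK_le f u : pos_cont f -> sphere u -> polar_fun (polar_fun f) u <= f u.
Proof.
move=> pf su; apply: polar_fun_le => [|v sv]; first exact: pos_cont_polar_fun.
by rewrite dotvC dotv_le_polar_fun.
Qed.

(** The usual Galois connection argument: the bipolar lies below the function and polarity reverses
    order. Hence the bipolar of [f] and the polar of [f] are dual to each other. *)
Lemma polar_funKK f u : pos_cont f -> sphere u ->
  polar_fun (polar_fun (polar_fun f)) u = polar_fun f u.
Proof.
move=> pf su; have pp := pos_cont_polar_fun pf; have ppp := pos_cont_polar_fun pp.
apply/eqP; rewrite eq_le polar_funK_le//=.
by apply: polar_fun_anti => // v sv; exact: polar_funK_le.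
Qed.

End PolarFunction.

(** * Lipschitz images of bounded pieces of hyperplanes are null *)

Section NullSets.
Context {R : realType} {n : nat} (n0 : (0 < n)%N).
Local Notation V := 'rV[R]_n.

Lemma leb_null_finite_cover (A : set V) :
  (forall eps : R, 0 < eps -> exists (I : finType) (a b : I -> V),
    [/\ forall k i, a k ord0 i <= b k ord0 i,
     forall x, A x -> exists k, forall i, a k ord0 i <= x ord0 i <= b k ord0 i &
     \sum_k \prod_(i < n) (b k ord0 i - a k ord0 i) < eps]) ->
  leb_null A.
Proof.
move=> h eps /h[I [a [b [ab Ab sab]]]].
(* Beyond the finite family both corners default to 0; such a box has volume 0 because n > 0. *)
pose pad (c : I -> V) (k : nat) : V :=
  if @insub nat (fun i => i < #|I|)%N 'I_#|I| k is Some o then c (enum_val o) else 0.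
exists (pad a), (pad b); split; [|split].
- by move=> k i; rewrite /pad; case: insub => //=.
- move=> x /Ab[k hk]; exists (enum_rank k) => i; rewrite /pad.
  by rewrite insubT//= => lt; rewrite (_ : Sub _ _ = enum_rank k) ?enum_rankK//; exact: val_inj.
- rewrite (nneseries_split 0 #|I|)/=; last first.
    move=> k _; rewrite lee_fin; apply: prodr_ge0 => i _.
    by rewrite subr_ge0 /pad; case: insub => //=.
  rewrite eseries0 ?adde0; last first.
    move=> k; rewrite add0n => Ik _ /=; rewrite /pad insubF ?ltnNge ?Ik//.
    by rewrite (bigD1 (Ordinal n0))//= subrr mul0r.
  rewrite add0n big_mkord sumEFin lte_fin; apply: le_lt_trans sab.
  rewrite [leRHS](reindex (@enum_val I predT))//=; last first.
    by apply: onW_bij; exact: enum_val_bij.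
  by apply: ler_sum => o _; rewrite /pad valK.
Qed.

(* Since one coordinate is frozen, a grid of mesh about [1 / N] has only
   [N ^ (n - 1)] cells; their images lie in cubes of volume [O(N ^- n)]. *)
Lemma leb_null_lipschitz (T : set (V * V)) (j : 'I_n) (c M L : R) :
  0 < M -> 0 < L ->
  (forall t, T t -> t.1 ord0 j = c /\ `|t.1| <= M) ->
  (forall t s, T t -> T s -> `|t.2 - s.2| <= L * `|t.1 - s.1|) ->
  leb_null [set t.2 | t in T].
Proof.
move=> M0 L0 TM TL; apply: leb_null_finite_cover => eps eps0.
(* Strictly longer than the range [-M, M] of the coordinates, so that truncated cell indices stay
   below N + 1. *)
pose D := 2 * M + 1; have D0 : 0 < D by rewrite /D; lra.
(* There are (N + 1)^(n - 1) cubes of side 2 L D / (N + 1), of total volume C / (N + 1). *)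
pose C := (2 * (L * D)) ^+ n; have C0 : 0 < C by rewrite exprn_gt0// !mulr_gt0.
have [N hN] : exists N : nat, C / N.+1%:R < eps.
  exists (Num.truncn (C / eps)); rewrite ltr_pdivrMr// mulrC -ltr_pdivrMr//.
  by have /truncn_itv/andP[] : 0 <= C / eps by rewrite ltW// divr_gt0.
pose cell (z : V) : {ffun 'I_n.-1 -> 'I_N.+1} :=
  [ffun k => inord (Num.truncn ((z ord0 (lift j k) + M) / D * N.+1%:R))].
(* Each cube is centred at the image of one chosen point of its cell. An empty cell gets a cube at
   0, which only enters the volume count. *)
pose rep cl := xget (0, 0) [set t | T t /\ cell t.1 = cl].
pose w := L * (D / N.+1%:R); have w0 : 0 < w by rewrite mulr_gt0// divr_gt0.
exists {ffun 'I_n.-1 -> 'I_N.+1},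
  (fun cl => (rep cl).2 - const_mx w), (fun cl => (rep cl).2 + const_mx w).
split.
- by move=> k i; rewrite !mxE; lra.
- move=> _ [t Tt <-]; exists (cell t.1) => i.
  have [Tr cr] : T (rep (cell t.1)) /\ cell (rep (cell t.1)).1 = cell t.1.
    by apply: (@xgetPex _ (0, 0) [set t' | T t' /\ cell t'.1 = cell t.1]); exists t.
  suff : `|t.2 - (rep (cell t.1)).2| <= w.
    by move=> /(le_trans (coord_le_norm _ i)); rewrite !mxE ler_norml; lra.
  move: (rep _) Tr cr => s Ts cs.
  apply: le_trans (TL _ _ Tt Ts) _; rewrite ler_pM2l//; apply: norm_le_coord => [|k].
    by rewrite divr_ge0// ltW.
  rewrite !mxE; case: (unliftP j k) => [k' ->|->].
    have /ffunP/(_ k') := cs; rewrite !ffunE => /(congr1 val) /=.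
    have bnd t' : T t' -> 0 <= (t'.1 ord0 (lift j k') + M) / D * N.+1%:R < N.+1%:R.
      move=> /TM[_ /(le_trans (coord_le_norm _ (lift j k')))]; rewrite ler_norml => /andP[h1 h2].
      rewrite mulr_ge0 ?divr_ge0 ?(ltW D0)//=; last by lra.
      by rewrite -ltr_pdivlMr// divff// ltr_pdivrMr// /D; lra.
    have /andP[t1 t2] := bnd _ Tt; have /andP[s1 s2] := bnd _ Ts.
    rewrite !inordK ?truncn_lt_nat// => e.
    have := truncn_itv t1; have := truncn_itv s1; rewrite e -[(Num.truncn _).+1%:R]natr1.
    set X := _ / D * _; set Y := _ / D * _ => /andP[X1 X2] /andP[Y1 Y2].
    have -> : t.1 ord0 (lift j k') - s.1 ord0 (lift j k') = (X - Y) * (D / N.+1%:R).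
      by rewrite /X /Y; field; rewrite !gt_eqF// addrC natr1.
    rewrite normrM (gtr0_norm (_ : 0 < D / N.+1%:R)) ?divr_gt0//.
    rewrite ler_piMl ?divr_ge0 ?(ltW D0)// ler_norml; lra.
  by rewrite (TM _ Tt).1 (TM _ Ts).1 subrr normr0 divr_ge0// ltW.
- rewrite (eq_bigr (fun=> \prod_(i < n) (2 * w))); last first.
    by move=> cl _; apply: eq_bigr => i _; rewrite !mxE; ring.
  rewrite sumr_const card_ffun !card_ord prodr_const card_ord.
  apply: le_lt_trans hN; rewrite -[leLHS]mulr_natr natrX.
  have -> : 2 * w = 2 * (L * D) / N.+1%:R by rewrite /w; field; rewrite gt_eqF// addrC natr1.
  rewrite expr_div_n -/C -{1}(prednK n0) exprS invfM -!mulrA mulVf ?mulr1//.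
Qed.

End NullSets.

(** * Wulff shapes *)

Section WulffShape.
Context {R : realType} {n : nat} (n0 : (0 < n)%N).
Local Notation V := 'rV[R]_n.
Implicit Types (u v x y xi : V) (h q : V -> R).

Definition wulff h : set V := [set x | forall u, sphere u -> dotv u x <= h u].

Definition dual_pair h q :=
  [/\ pos_cont h, pos_cont q, forall u, sphere u -> h u = polar_fun q u &
     forall xi, sphere xi -> q xi = polar_fun h xi].

Lemma convex_body_wulff h : pos_cont h -> convex_body_o (wulff h).
Proof.
move=> ph; have [e e0 he] := pos_cont_bounds n0 ph; split; [|split].
- move=> x y t Kx Ky /andP[t0 t1] u su; rewrite dotvDr !dotvZr.
  have := Kx u su; have := Ky u su => h1 h2.
  have -> : h u = t * h u + (1 - t) * h u by ring.
  by rewrite lerD// ler_wpM2l// subr_ge0.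
- apply: bounded_closed_compact.
    exists e^-1; split; first exact: num_real.
    move=> M eM x Kx; apply: le_trans (ltW eM).
    apply: norm_le_coord => [|i]; first by rewrite invr_ge0 ltW.
    pose d : V := \row_k (k == i)%:R.
    have dx y : dotv d y = y ord0 i.
      rewrite /dotv (bigD1 i)//= !mxE eqxx mul1r big1 ?addr0// => k /negPf ki.
      by rewrite !mxE ki mul0r.
    have sd : sphere d by rewrite /sphere /= dx mxE eqxx.
    have sNd : sphere (- d) by rewrite /sphere /= dotvNl dotvNr opprK.
    have := Kx _ sd; have := Kx _ sNd; rewrite dotvNl dx ler_norml.
    have /andP[_] := he _ sd; have /andP[_] := he _ sNd; lra.
  have -> : wulff h = \bigcap_(u in sphere) (dotv u @^-1` [set t | t <= h u]).
    by apply/seteqP; split => [x Kx u su|x Kx u su]; exact: Kx.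
  apply: closed_bigI => u _; apply: preimage_closed; last exact: closed_le.
  by move=> x _; exact: continuous_dotvr.
- have n0R : 0 < n%:R :> R by rewrite ltr0n.
  suff : nbhs (0 : V) (wulff h) by [].
  rewrite -(@nbhs_nbhs_norm R V); exists (e / n%:R) => /=; first by rewrite divr_gt0.
  move=> x; rewrite /ball_ /= sub0r normrN => xe u su.
  apply: le_trans (ler_norm _) _; apply: le_trans (norm_dotv _ su) _.
  have /andP[+ _] := he u su; apply: le_trans.
  by rewrite mulrC -ler_pdivlMr// ltW.
Qed.

Section DualPair.
Context {h q : V -> R} (hq : dual_pair h q).

Let ph : pos_cont h. Proof. by case: hq. Qed.
Let pq : pos_cont q. Proof. by case: hq. Qed.
Let h0 u : sphere u -> 0 < h u. Proof. by case: ph => _; exact. Qed.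
Let q0 u : sphere u -> 0 < q u. Proof. by case: pq => _; exact. Qed.

Lemma dual_pair_dotv_le u xi : sphere u -> sphere xi -> dotv u xi <= h u * q xi.
Proof. by move=> su sx; have [_ _ _ ->//] := hq; exact: dotv_le_polar_fun. Qed.

Lemma wulff_rayE xi (t : R) : sphere xi -> 0 <= t -> wulff h (t *: xi) <-> t <= (q xi)^-1.
Proof.
move=> sx t0; split => [Kt|tq u su].
  have [u su [+ _]] := polar_fun_max n0 xi ph; have [_ _ _ <-//] := hq => qE.
  have := Kt u su; rewrite dotvZr => tu.
  rewrite -[leRHS]mul1r ler_pdivlMr ?q0// qE mulrA ler_pdivrMr ?h0// mul1r.
  exact: tu.
rewrite dotvZr; have [u0|u0] := leP (dotv u xi) 0.
  by apply: le_trans (ltW (h0 su)); rewrite mulr_ge0_le0.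
apply: le_trans (_ : (q xi)^-1 * dotv u xi <= _); first by rewrite ler_pM2r.
by rewrite mulrC ler_pdivrMr ?q0//; exact: dual_pair_dotv_le.
Qed.

Lemma radial_wulff xi : sphere xi -> radial (wulff h) xi = (q xi)^-1.
Proof.
move=> sx; rewrite /radial.
have -> : [set t : R | 0 <= t /\ wulff h (t *: xi)] = `[0, (q xi)^-1]%classic.
  apply/seteqP; split => t /=; rewrite in_itv/=.
    by move=> [t0 /wulff_rayE->]//; rewrite t0.
  by move=> /andP[t0 tq]; split => //; exact/wulff_rayE.
by rewrite sup_itvcc// invr_ge0 ltW ?q0.
Qed.

(** The bound is attained because [h] is itself a polar function: a maximising direction for
    [polar_fun q u], scaled to the boundary, touches the supporting hyperplane. *)
Lemma wulff_dotv_max u : sphere u ->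
  (forall y, wulff h y -> dotv u y <= h u) /\ exists2 y, wulff h y & dotv u y = h u.
Proof.
move=> su; split => [y Ky|]; first exact: Ky.
have [xi sx [+ _]] := polar_fun_max n0 u pq; have [_ _ <-// _] := hq => hE.
exists ((q xi)^-1 *: xi); last by rewrite dotvZr hE dotvC mulrC.
by apply/wulff_rayE => //; rewrite invr_ge0 ltW ?q0.
Qed.

Lemma radial_polar_wulff u : sphere u -> radial (polar (wulff h)) u = (h u)^-1.
Proof.
move=> su; rewrite /radial; have [Ku [z Kz zE]] := wulff_dotv_max su.
have -> : [set t : R | 0 <= t /\ polar (wulff h) (t *: u)] = `[0, (h u)^-1]%classic.
  apply/seteqP; split => t /=; rewrite in_itv/=.
    move=> [t0 /(_ _ Kz)]; rewrite t0/= dotvZl zE.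
    by rewrite -[(h u)^-1]mul1r ler_pdivlMr ?h0.
  move=> /andP[t0 tq]; split => // y Ky; rewrite dotvZl.
  apply: le_trans (_ : t * h u <= 1); first by rewrite ler_wpM2l// Ku.
  by rewrite -ler_pdivlMr ?h0// mul1r.
by rewrite sup_itvcc// invr_ge0 ltW ?h0.
Qed.

(** Normals are the equality cases of u . xi <= h u * q xi, that is, the maximisers in
    [polar_fun h xi]. All later use of normals goes through this analytic form. *)
Lemma radial_gauss_wulffE xi u : sphere xi ->
  radial_gauss_set (wulff h) xi u <-> sphere u /\ dotv u xi = h u * q xi.
Proof.
move=> sx; rewrite /radial_gauss_set /normals radial_wulff//=.
split => -[su H]; split => //.
  have [_ [z Kz zE]] := wulff_dotv_max su.
  apply/eqP; rewrite eq_le dual_pair_dotv_le//= -ler_pdivlMr ?q0//.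
  by rewrite mulrC -zE; have := H _ Kz; rewrite dotvZl !(dotvC _ u).
move=> y Ky; rewrite dotvZl (dotvC xi) H mulrC mulfK ?gt_eqF ?q0// dotvC.
exact: Ky.
Qed.

Lemma radial_gauss_wulff_neq0 xi : sphere xi ->
  exists u, radial_gauss_set (wulff h) xi u.
Proof.
move=> sx; have [u su [+ _]] := polar_fun_max n0 xi ph; have [_ _ _ <-//] := hq => qE.
exists u; apply/radial_gauss_wulffE => //; split => //.
by rewrite qE mulrC divfK// gt_eqF ?h0.
Qed.

Lemma radial_gauss_wulffP xi : sphere xi ->
  sphere (radial_gauss (wulff h) xi) /\
  dotv (radial_gauss (wulff h) xi) xi = h (radial_gauss (wulff h) xi) * q xi.
Proof.
move=> sx; apply/radial_gauss_wulffE => //.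
have [u Ku] := radial_gauss_wulff_neq0 sx.
exact: (xgetPex 0 (ex_intro _ u Ku)).
Qed.

End DualPair.
End WulffShape.

(** * Directions with several normals *)

Section SingularDirections.
Context {R : realType} {n : nat} (n0 : (0 < n)%N).
Local Notation V := 'rV[R]_n.
Implicit Types (u v w x y xi : V) (h q : V -> R).

Definition normal_at (K : set V) x w := forall y, K y -> dotv y w <= dotv x w.

(** Normal cones are monotone, (x - y) . (w - w') >= 0, so adding the normals can only increase the
    distance. The vectors [w] need not be unit. *)
Lemma normal_at_nonexpansive (K : set V) x w y w' : K x -> K y ->
  normal_at K x w -> normal_at K y w' ->
  dotv (x - y) (x - y) <= dotv ((x + w) - (y + w')) ((x + w) - (y + w')).
Proof.
move=> Kx Ky /(_ _ Ky) xw /(_ _ Kx) yw.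
have -> : (x + w) - (y + w') = (x - y) + (w - w') by rewrite opprD addrACA.
have : 0 <= dotv (x - y) (w - w') by rewrite dotvBr !dotvBl; lra.
move: (x - y) (w - w') (dotv_ge0 (w - w')) => d d' d'0 dd'.
by rewrite dotvDr !dotvDl (dotvC d' d); lra.
Qed.

(* The sector [x + r u + s v], with [r, s >= 0], projects onto a set with interior
   in some pair of coordinates, hence contains a point where both are rational. *)
Lemma rational_normal (K : set V) x u v : sphere u -> sphere v -> u <> v -> u <> - v ->
  normal_at K x u -> normal_at K x v ->
  exists i j (a b : rat) w, [/\ i != j, `|w| <= 4, normal_at K x w,
    (x + w) ord0 i = ratr a & (x + w) ord0 j = ratr b].
Proof.
move=> su sv uv uNv Nu Nv.
(* Two unit vectors that are neither equal nor opposite are independent, so some 2 x 2 minor is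
   nonzero. *)
have [i [j D0]] : exists i j, u ord0 i * v ord0 j - u ord0 j * v ord0 i != 0.
  apply: contrapT => h; pose c := dotv u v.
  have vE : v = c *: u.
    apply/rowP => j; rewrite mxE /c /dotv mulr_suml.
    rewrite -[LHS]mul1r -[X in X * _]su /dotv mulr_suml; apply: eq_bigr => i _.
    have /eqP := contrapT (fun hn => h (ex_intro _ i (ex_intro _ j (introN eqP hn)))).
    by rewrite subr_eq0 => /eqP e; rewrite -mulrA e; ring.
  have : c ^+ 2 = 1.
    by move: sv; rewrite /sphere /= {1}vE dotvZl {1}vE dotvZr su mulr1 expr2.
  move/eqP; rewrite sqrf_eq1 => /orP[] /eqP c1.
    by apply: uv; rewrite vE c1 scale1r.
  by apply: uNv; rewrite vE c1 scaleN1r opprK.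
have ij : i != j by apply: contraNneq D0 => ->; rewrite subrr.
set D := _ - _ in D0.
have Dgt : 0 < `|D| by rewrite normr_gt0.
(* The tolerance makes the corrections [r] and [s] at most 1 in absolute value. Starting from x + u
   + v, the coefficients 1 + r and 1 + s then lie in [0, 2]: the vector stays in the normal cone and
   has norm at most 4. *)
have near_rat (c : R) : exists2 p : rat, 0 <= ratr p - c & ratr p - c <= `|D| / 2.
  have [p] : exists p : rat, ratr p \in `]c, (c + `|D| / 2)%R[%R.
    by apply: rat_in_itvoo; rewrite ltrDl divr_gt0.
  by rewrite in_itv/= => /andP[p1 p2]; exists p; lra.
have [a a0 a1] := near_rat ((x + u + v) ord0 i).
have [b b0 b1] := near_rat ((x + u + v) ord0 j).
pose ea := ratr a - (x + u + v) ord0 i; pose eb := ratr b - (x + u + v) ord0 j.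
have ea1 : `|ea| <= `|D| / 2 by rewrite ger0_norm.
have eb1 : `|eb| <= `|D| / 2 by rewrite ger0_norm.
(* Cramer's rule *)
pose r := (ea * v ord0 j - eb * v ord0 i) / D.
pose s := (eb * u ord0 i - ea * u ord0 j) / D.
have bnd e1 e2 c1 c2 : `|e1| <= `|D| / 2 -> `|e2| <= `|D| / 2 -> `|c1| <= 1 -> `|c2| <= 1 ->
    `|(e1 * c1 - e2 * c2) / D| <= 1.
  move=> h1 h2 k1 k2; rewrite normrM normfV ler_pdivrMr// mul1r.
  apply: le_trans (ler_normB _ _) _; rewrite !normrM [leRHS](splitr `|D|).
  by rewrite lerD// -[leRHS]mulr1 ler_pM.
have r1 : `|r| <= 1 by apply: bnd => //; exact: sphere_coord.
have s1 : `|s| <= 1 by apply: bnd => //; exact: sphere_coord.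
exists i, j, a, b, ((1 + r) *: u + (1 + s) *: v); split => //.
- apply: norm_le_coord => // k; rewrite !mxE.
  have := sphere_coord k su; have := sphere_coord k sv.
  move: r1 s1; rewrite !ler_norml => /andP[? ?] /andP[? ?] /andP[? ?] /andP[? ?].
  by apply/andP; split; nra.
- move=> y Ky; rewrite !dotvDr !dotvZr.
  move: r1 s1; rewrite !ler_norml => /andP[? ?] /andP[? ?].
  by rewrite lerD// ler_wpM2l ?Nu ?Nv//; lra.
- have -> : ratr a = ea + (x + u + v) ord0 i by rewrite /ea subrK.
  by rewrite !mxE /r /s /D; field.
- have -> : ratr b = eb + (x + u + v) ord0 j by rewrite /eb subrK.
  by rewrite !mxE /r /s /D; field.
Qed.

Context {h q : V -> R} (hq : dual_pair h q) (cq : continuous q).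

Let pq : pos_cont q. Proof. by case: hq. Qed.
Let q0 u : sphere u -> 0 < q u. Proof. by case: pq => _; exact. Qed.

(* The point [xi / q xi] is the boundary point in direction [xi]. *)
Definition normal_on_flat i j (a b : R) xi w := [/\ sphere xi, `|w| <= 4,
  normal_at (wulff h) ((q xi)^-1 *: xi) w,
  ((q xi)^-1 *: xi + w) ord0 i = a & ((q xi)^-1 *: xi + w) ord0 j = b].

Definition singular_piece i j a b := [set xi | exists w, normal_on_flat i j a b xi w].

(** It is the projection of a compact set of pairs (xi, w); the bound on [w] is there for this
    compactness. Multiplying by q xi turns the conditions into continuous equations and
    inequalities. Closedness gives the Borel measurability that [classM] asks for. *)
Lemma closed_singular_piece i j a b : closed (singular_piece i j a b).
Proof.
pose C := [set p : V * V | normal_on_flat i j a b p.1 p.2].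
have -> : singular_piece i j a b = fst @` C.
  apply/seteqP; split => [xi [w H]|_ [p H <-]]; first by exists (xi, w).
  by exists p.2.
apply: compact_closed; first exact: norm_hausdorff.
apply: continuous_compact.
  by apply: continuous_subspaceT => p; exact: cvg_fst.
have cB : compact ([set w : V | `|w| <= 4]).
  apply: bounded_closed_compact.
    exists 4; split; first exact: num_real.
    by move=> M M4 w /= w4; apply: le_trans w4 (ltW M4).
  have -> : [set w : V | `|w| <= 4] = (fun w : V => `|w|) @^-1` [set t | t <= 4] by [].
  by apply: preimage_closed; [move=> w _; exact: norm_continuous|exact: closed_le].
apply: (subclosed_compact _ (compact_setX (@compact_sphere R n) cB)).
  have c1 : continuous (fun p : V * V => p.1) by move=> p; exact: cvg_fst.
  have c2 : continuous (fun p : V * V => p.2) by move=> p; exact: cvg_snd.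
  have cq1 : continuous (fun p : V * V => q p.1).
    by move=> p; exact: (@continuous_comp _ _ _ fst q p (c1 p) (@cq p.1)).
  have cc k (f : V * V -> V) : continuous f -> continuous (fun p => f p ord0 k).
    by move=> cf p; exact: (continuous_comp (cf p) (@coord_continuous _ _ _ _ _ _)).
  have -> : C = [set p : V * V | dotv p.1 p.1 - 1 = 0] `&`
      [set p : V * V | `|p.2| - 4 <= 0] `&`
      (\bigcap_(y in wulff h) [set p : V * V | q p.1 * dotv y p.2 - dotv p.1 p.2 <= 0]) `&`
      [set p : V * V | p.1 ord0 i + q p.1 * p.2 ord0 i - a * q p.1 = 0] `&`
      [set p : V * V | p.1 ord0 j + q p.1 * p.2 ord0 j - b * q p.1 = 0].
    have eq_mul xi (c d e : R) : sphere xi ->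
        ((q xi)^-1 * c + d = e) <-> (c + q xi * d - e * q xi = 0).
      move=> sx; have qx : q xi != 0 by rewrite gt_eqF ?q0.
      split => [<-|]; first by field.
      move/eqP; rewrite subr_eq0 => /eqP ed; apply: (mulIf qx); rewrite -ed; field.
      exact: qx.
    have le_mul xi (c d : R) : sphere xi ->
        (c <= (q xi)^-1 * d) <-> (q xi * c - d <= 0).
      by move=> sx; rewrite subr_le0 -ler_pdivlMl ?q0.
    apply/seteqP; split => [[xi w] [/= sx w4 Nw wi wj]|[xi w] /= [[[[sx w4] Nw] wi] wj]].
      rewrite !mxE in wi wj; move/eq_mul in wi; move/eq_mul in wj.
      split; [split; [split; [split|]|]|] => /=.
      - by move: (sx) => /= ->; rewrite subrr.
      - by rewrite subr_le0.
      - by move=> y Ky /=; apply/le_mul => //; rewrite -dotvZl; exact: Nw.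
      - exact: wi.
      - exact: wj.
    have sx' : sphere xi by move/eqP: sx; rewrite subr_eq0 => /eqP.
    split => //=.
    - by rewrite -subr_le0.
    - by move=> y Ky; rewrite dotvZl; apply/le_mul => //; exact: Nw.
    - by rewrite !mxE; exact/eq_mul.
    - by rewrite !mxE; exact/eq_mul.
  have closed0 (f : V * V -> R) : continuous f -> closed [set p | f p = 0].
    move=> cf; have -> : [set p | f p = 0] = f @^-1` [set t | t = 0] by [].
    by apply: preimage_closed; [move=> p _; exact: cf|exact: closed_eq].
  have closedle0 (f : V * V -> R) : continuous f -> closed [set p | f p <= 0].
    move=> cf; have -> : [set p | f p <= 0] = f @^-1` [set t | t <= 0] by [].
    by apply: preimage_closed; [move=> p _; exact: cf|exact: closed_le].
  have cM (f g : V * V -> R) : continuous f -> continuous g -> continuous (fun p => f p * g p).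
    by move=> cf cg p; apply: cvgM; [exact: cf|exact: cg].
  have cB' (f g : V * V -> R) : continuous f -> continuous g -> continuous (fun p => f p - g p).
    by move=> cf cg p; apply: cvgB; [exact: cf|exact: cg].
  have cD (f g : V * V -> R) : continuous f -> continuous g -> continuous (fun p => f p + g p).
    by move=> cf cg p; apply: cvgD; [exact: cf|exact: cg].
  have ck (c : R) : continuous (fun _ : V * V => c) by move=> p; exact: cvg_cst.
  have cdot (f g : V * V -> V) : continuous f -> continuous g ->
    continuous (fun p => dotv (f p) (g p)) by exact: continuous_dotv.
  apply: closedI; [apply: closedI; [apply: closedI; [apply: closedI|]|]|].
  - by apply: closed0; apply: cB' => //; exact: cdot.
  - apply: closedle0; apply: cB' => // p.
    exact: (@continuous_comp _ _ _ snd (fun w : V => `|w|) p (c2 p) (@norm_continuous _ _ p.2)).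
  - apply: closed_bigI => y _; apply: closedle0; apply: cB'; last exact: cdot.
    by apply: cM => //; apply: cdot => // p; exact: cvg_cst.
  - by apply: closed0; apply: cB'; [apply: cD; [exact: cc|apply: cM => //; exact: cc]|exact: cM].
  - by apply: closed0; apply: cB'; [apply: cD; [exact: cc|apply: cM => //; exact: cc]|exact: cM].
by move=> p [sp p2 _ _ _].
Qed.

(** With x = xi / q xi, the point x + w determines x in a Lipschitz way and has two frozen
    coordinates. A cone over the piece needs one more parameter t: it is stored in coordinate i,
    whose value [a] carries no information, while coordinate j keeps the data in a hyperplane. *)
Lemma sph_null_singular_piece i j a b : i != j -> sph_null (singular_piece i j a b).
Proof.
move=> ij; have [e e0 he] := pos_cont_bounds n0 pq.
have ei0 : 0 < e^-1 by rewrite invr_gt0.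
(* Coordinate i holds t * q xi rather than t, because t xi = (t * q xi) x. *)
pose T := [set zp : V * V | exists xi w (t : R), [/\ 0 < t <= 1, normal_on_flat i j a b xi w,
  zp.1 = \row_k (if k == i then t * q xi else ((q xi)^-1 *: xi + w) ord0 k) & zp.2 = t *: xi]].
have nR : 1 <= n%:R :> R by rewrite ler1n.
rewrite /sph_null (_ : [set y | _] = [set zp.2 | zp in T]); last first.
  apply/seteqP; split => [y [t [xi [t01 [[w H] ->]]]]|_ [[z p] [xi [w [t [t01 H _ /= ->]]]] <-]].
    exists (\row_k (if k == i then t * q xi else ((q xi)^-1 *: xi + w) ord0 k), t *: xi) => //=.
    by exists xi, w, t.
  by exists t, xi; split => //; split => //; exists w.
have Kx xi : sphere xi -> wulff h ((q xi)^-1 *: xi).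
  by move=> sx; apply/(wulff_rayE n0 hq) => //; rewrite invr_ge0 ltW// q0.
have x1 xi : sphere xi -> `|(q xi)^-1 *: xi| <= e^-1.
  move=> sx; rewrite normrZ gtr0_norm ?invr_gt0 ?q0// -[leRHS]mulr1.
  rewrite ler_pM ?invr_ge0 ?(ltW (q0 sx))//.
    by have /andP[? _] := he _ sx; rewrite lef_pV2 ?posrE ?q0.
  by apply: norm_le_coord => // k; exact: sphere_coord.
apply: (@leb_null_lipschitz _ _ n0 _ j b (4 + e^-1) (e^-1 * (1 + n%:R))).
- by rewrite addr_gt0.
- by rewrite mulr_gt0// addr_gt0// ltr0n.
- move=> _ [xi [w [t [/andP[t0 t1] [sx w4 Nw _ wj] -> _]]]]; rewrite mxE.
  rewrite eq_sym (negPf ij) wj; split => //; apply: norm_le_coord => [|k].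
    by rewrite addr_ge0// ltW.
  rewrite mxE; case: ifP => _.
    rewrite ger0_norm ?mulr_ge0 ?(ltW t0) ?(ltW (q0 sx))//.
    have /andP[_ qe] := he _ sx; apply: le_trans (_ : q xi <= _).
      by rewrite ler_piMl// ltW// q0.
    by apply: le_trans qe _; rewrite lerDr.
  apply: le_trans (coord_le_norm _ k) _; apply: le_trans (ler_normD _ _) _.
  by rewrite addrC lerD// x1.
- move=> _ _ [xi [w [t [/andP[t0 t1] [sx w4 Nw wi wj] -> ->]]]]
    [yi [w' [t' [/andP[t0' t1'] [sy w4' Nw' wi' wj'] -> ->]]]].
  set z := \row_k _; set z' := \row_k _.
  set x := _ *: xi in wi wj Nw; set y := _ *: yi in wi' wj' Nw'.
  have zi : `|t * q xi - t' * q yi| <= `|z - z'|.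
    by have := coord_le_norm (z - z') i; rewrite !mxE eqxx.
  have xy : `|x - y| <= n%:R * `|z - z'|.
    apply: norm_le_coord => [|k]; first by rewrite mulr_ge0.
    rewrite -ler_sqr ?nnegrE ?mulr_ge0// real_normK ?num_real//.
    apply: le_trans (sqr_coord_le _ _) _.
    apply: le_trans (normal_at_nonexpansive (Kx _ sx) (Kx _ sy) Nw Nw') _.
    apply: (@le_trans _ _ (\sum_(k < n) `|z - z'| ^+ 2)).
      apply: ler_sum => l _; rewrite -expr2 -real_normK ?num_real// ler_sqr ?nnegrE//.
      rewrite !mxE; have := coord_le_norm (z - z') l; rewrite !mxE.
      have [->|li] := eqVneq l i; first by move: wi wi'; rewrite !mxE => -> ->; rewrite subrr normr0.
      by [].
    rewrite sumr_const card_ord exprMn -[leLHS]mulr_natl ler_wpM2r ?sqr_ge0//.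
    by rewrite expr2 ler_peMl.
  (* The first factor is the difference of the coordinates i of z and z'; the second term is
     controlled by nonexpansiveness. *)
  have -> : t *: xi - t' *: yi = (t * q xi - t' * q yi) *: x + (t' * q yi) *: (x - y).
    rewrite scalerBl scalerBr /x /y !scalerA !mulfK ?gt_eqF ?q0//.
    by rewrite addrA subrK.
  apply: le_trans (ler_normD _ _) _; rewrite (normrZ _ x) (normrZ _ (x - y)) mulrDr mulr1 mulrDl lerD//.
    by rewrite mulrC ler_pM//; exact: x1.
  rewrite -mulrA ler_pM// gtr0_norm ?mulr_gt0 ?q0//.
  have /andP[_ qe] := he _ sy; apply: le_trans qe.
  by rewrite ler_piMl// ltW// q0.
Qed.

End SingularDirections.

(** * Borel measurability and bounded integrals *)

Section BorelSets.
Context {R : realType} {n : nat}.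
Local Notation V := 'rV[R]_n.

Lemma measurable_open_Rn (A : set V) : open A -> measurable (A : set (Rn R n)).
Proof. by move=> oA; exact: sub_sigma_algebra. Qed.

Lemma measurable_closed_Rn (A : set V) : closed A -> measurable (A : set (Rn R n)).
Proof.
move=> cA; rewrite -[A]setCK; apply: measurableC.
by apply: measurable_open_Rn; exact: closed_openC.
Qed.

Lemma measurable_sphere : measurable (sphere : set (Rn R n)).
Proof. by apply: measurable_closed_Rn; exact: closed_sphere. Qed.

Lemma measurable_fun_within_continuous (D : set V) (f : V -> R) :
  measurable (D : set (Rn R n)) -> {within D, continuous f} ->
  measurable_fun (D : set (Rn R n)) f.
Proof.
move=> mD cf; apply: (measurability _ (RGenOInfty.measurableE R)).
move=> _ [_ [a ->] <-].
have oa : open (`]a, +oo[%classic : set R) by rewrite set_itvE; exact: open_gt.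
have /continuousP/(_ _ oa) := cf; move=> /open_subspaceP[U oU UD].
rewrite setIC /preimage/= -UD; apply: measurableI => //; exact: measurable_open_Rn.
Qed.

End BorelSets.

Section BoundedIntegrals.
Context {d : measure_display} {T : measurableType d} {R : realType}.
Context (mu : {measure set T -> \bar R}) (D : set T) (mD : measurable D).
Context (muD : (mu D < +oo)%E).

Lemma integrable_bounded_by (f : T -> R) (M : R) : measurable_fun D f ->
  (forall x, D x -> `|f x| <= M) -> mu.-integrable D (EFin \o f).
Proof.
move=> mf fM; apply: measurable_bounded_integrable => //.
exists M; split; first exact: num_real.
by move=> N MN x /= Dx; apply: le_trans (fM _ Dx) (ltW MN).
Qed.

Lemma cvg_Rintegral_bounded (f_ : nat -> T -> R) (f : T -> R) (M : R) :
  (forall k, measurable_fun D (f_ k)) ->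
  (forall k x, D x -> `|f_ k x| <= M) ->
  (forall x, D x -> f_ k x @[k --> \oo] --> f x) ->
  \int[mu]_(x in D) f_ k x @[k --> \oo] --> \int[mu]_(x in D) f x.
Proof.
move=> mf fM ff.
have mlim : measurable_fun D f.
  by apply: (measurable_fun_cvg mf) => x Dx; exact: ff.
have fb x : D x -> `|f x| <= M.
  move=> Dx; have : `|f_ k x| @[k --> \oo] --> `|f x| by apply: cvg_norm; exact: ff.
  by move=> /cvgr_to_le; apply; apply: nearW => k; exact: fM.
apply: fine_cvg; rewrite /= fineK; last first.
  by apply: integrable_fin_num => //; exact: integrable_bounded_by fb.
apply: (@dominated_cvg _ _ _ mu D mD (fun k x => (f_ k x)%:E) (fun x => (f x)%:E) (fun=> M%:E)) => //.
- by move=> k; exact/measurable_EFinP.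
- by move=> x Dx; apply: cvg_EFin; [exact: nearW|exact: ff].
- apply: (integrable_bounded_by (f := fun=> M) (M := `|M|)); first exact: measurable_cst.
  by [].
Qed.

End BoundedIntegrals.

Section NullExceptions.
Import HBNNSimple.
Context {d : measure_display} {T : measurableType d} {R : realType}.
Context (mu : {measure set T -> \bar R}).
Local Open Scope ereal_scope.

(* Neither [D] nor [f] need be measurable: the integral is a supremum over the
   simple functions below [f], and these may be cut off on a null set. *)
Lemma integral_null_setD (D N : set T) (f : T -> \bar R) :
  measurable N -> mu N = 0 -> (forall x, D x -> 0 <= f x) ->
  \int[mu]_(x in D) f x = \int[mu]_(x in D `\` N) f x.
Proof.
move=> mN muN f0; have mNC : measurable (~` N) by exact: measurableC.
have f0' x : (D `\` N) x -> 0 <= f x by move=> [/f0].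
rewrite !ge0_integralE//; apply/eqP; rewrite eq_le; apply/andP; split.
  rewrite ge_ereal_sup// => _ [g /= gf <-].
  apply: le_ereal_sup_tmp; exists (sintegral mu (proj_nnsfun g mNC)).
    exists (proj_nnsfun g mNC) => //= x; rewrite mindicE.
    have := gf x; rewrite /patch in_setD in_setC.
    case: (x \in D) => /=; case: (x \in N) => //=; rewrite ?mulr0 ?mulr1//.
  rewrite -[leLHS]integralT_nnsfun (ge0_negligible_integral mN)//; last 2 first.
    exact/measurable_EFinP.
    by move=> x _; rewrite lee_fin.
  by rewrite setTD integral_nnsfun// (mrestrict g mNC).
rewrite ge_ereal_sup// => _ [g /= gf <-].
apply: ereal_sup_ubound; exists g => //= x; apply: le_trans (gf x) _.
rewrite /patch in_setD; case: ifPn => [/andP[->//]|_].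
by case: ifPn => // xD; apply: f0; rewrite inE in xD.
Qed.

End NullExceptions.

(** * Integrands of class C *)

Section UniqueNormals.
Context {R : realType} {n : nat} (n0 : (0 < n)%N).
Local Notation V := 'rV[R]_n.

Lemma unique_normal_ae (h q : V -> R) (lam : {measure set (Rn R n) -> \bar R}) :
  dual_pair h q -> continuous q -> classM lam ->
  exists N : set (Rn R n), [/\ measurable N, lam N = 0%E &
    forall xi u v, sphere xi -> ~ N xi -> radial_gauss_set (wulff h) xi u ->
      radial_gauss_set (wulff h) xi v -> u = v].
Proof.
move=> hq cq [_ Mlam].
(* All flats with rational data, enumerated through [unpickle]; codes of no flat give the empty
   set. *)
pose F (k : nat) : set (Rn R n) :=
  if @unpickle ('I_n * 'I_n * rat * rat)%type k is Some (i, j, a, b) then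
    if i != j then @singular_piece R n h q i j (ratr a) (ratr b) else set0
  else set0.
have [N [mN N0 FN]] : lam.-negligible (\bigcup_k F k).
  apply: negligible_bigcup => k; rewrite /F.
  case: unpickle => [[[[i j] a] b]|]; last exact: negligible_set0.
  case: ifPn => [ij|_]; last exact: negligible_set0.
  have mp : measurable (@singular_piece R n h q i j (ratr a) (ratr b) : set (Rn R n)).
    by apply: measurable_closed_Rn; exact: closed_singular_piece.
  exists (@singular_piece R n h q i j (ratr a) (ratr b)); split => //.
  apply: Mlam => //; first by move=> xi [w []].
  exact: sph_null_singular_piece.
exists N; split => // xi u v sx Nxi Ku Kv; apply: contrapT => uv; apply: Nxi.
have q0 : 0 < q xi by case: hq => _ [_ +] _ _; apply.
have Nx w : radial_gauss_set (wulff h) xi w ->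
    sphere w /\ normal_at (wulff h) ((q xi)^-1 *: xi) w.
  by move=> [sw Hw]; split => // y Ky; rewrite -(radial_wulff n0 hq)//; exact: Hw.
have [su Nu] := Nx _ Ku; have [sv Nv] := Nx _ Kv.
(* Opposite normals cannot occur: both inner products with xi equal some h * q xi > 0, yet they
   would have opposite signs. *)
have uNv : u <> - v.
  have /(radial_gauss_wulffE n0 hq _ sx)[_ uE] := Ku.
  have /(radial_gauss_wulffE n0 hq _ sx)[_ vE] := Kv.
  move=> uv'; move: uE; rewrite uv' dotvNl vE => e.
  have [_ hp] : pos_cont h by case: hq.
  have hu : 0 < h v * q xi by rewrite mulr_gt0 ?hp.
  have : 0 < h (- v) * q xi by rewrite -uv' mulr_gt0 ?hp.
  by rewrite -e; lra.
have [i [j [a [b [w [ij w4 Nw wi wj]]]]]] := rational_normal su sv uv uNv Nu Nv.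
apply: FN; exists (pickle (i, j, a, b)) => //.
by rewrite /F pickleK ij; exists w.
Qed.

End UniqueNormals.

Section ClassC.
Context {R : realType} {n : nat} (n0 : (0 < n)%N).
Local Notation V := 'rV[R]_n.
Context (Phi : V -> R -> R) (C : classC Phi).

Lemma continuous_within_graph (F : V -> R -> R) (f : V -> R) :
  {within sph_dom (R := R) (n := n), continuous (fun p => F p.1 p.2)} ->
  pos_cont f -> {within sphere, continuous (fun u => F u (f u))}.
Proof.
move=> /subspace_continuousP cF [/subspace_continuousP cf f0].
apply/subspace_continuousP => x sx.
have := cF (x, f x) (conj sx (f0 _ sx)).
apply: (@cvg_comp _ _ _ (fun u => (u, f u)) (fun p => F p.1 p.2)).
move=> A /= wA.
have {}wA : nbhs (x, f x) [set p | sph_dom p -> A p] by exact: wA.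
have cu : (fun u => (u, f u)) @ within sphere (nbhs x) --> (x, f x).
  by apply: (@cvg_pair _ _ _ _ (nbhs x) (nbhs (f x)) _ _ _ id f); [exact: cvg_within|exact: cf].
have := cu _ wA; rewrite /nbhs /= /within /= => H.
by apply: filterS H => u H su; apply: H => //; split => //=; exact: f0.
Qed.

Lemma classC_mean_value u s t : sphere u -> 0 < s -> 0 < t ->
  exists2 c, Num.min s t <= c <= Num.max s t & Phi u t - Phi u s = dt Phi u c * (t - s).
Proof.
move=> su; wlog st : s t / s <= t.
  move=> H s0 t0; have [/H|ts] := boolP (s <= t); first exact.
  have [|c cst e] := H t s _ t0 s0; first by rewrite ltW// ltNge.
  exists c; first by rewrite minC maxC.
  by rewrite -opprB e; ring.
move=> s0 t0; rewrite min_l// max_r//.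
have [||c cst e] := @MVT_segment R (Phi u) (dt Phi u) s t st.
- move=> x; rewrite in_itv/= => /andP[sx _].
  have x0 : 0 < x by exact: lt_trans sx.
  have dx := C.1 u x su x0.
  by rewrite /dt derive1E; exact: DeriveDef.
- apply: derivable_within_continuous => x; rewrite in_itv/= => /andP[sx _].
  by apply: C.1 => //; exact: lt_le_trans sx.
- by exists c => //; move: cst; rewrite in_itv.
Qed.

Lemma classC_lipschitz (a b : R) : 0 < a -> exists2 M : R, 0 < M &
  forall u s t, sphere u -> a <= s <= b -> a <= t <= b ->
    `|Phi u t - Phi u s| <= M * `|t - s| /\ `|dt Phi u t| <= M.
Proof.
move=> a0.
have cAB : compact ((sphere : set V) `*` `[a, b]%classic).
  by apply: compact_setX; [exact: compact_sphere|exact: segment_compact].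
have cd : {within (sphere : set V) `*` `[a, b]%classic, continuous (fun p : V * R => `|dt Phi p.1 p.2|)}.
  apply: (@continuous_subspaceW _ _ _ (sph_dom (R := R) (n := n))).
    move=> [u t] /= [su]; rewrite in_itv/= => /andP[t1 _]; split => //=.
    exact: lt_le_trans t1.
  by move=> p; apply: cvg_norm; exact: C.2.2.
have [M M0 HM] : exists2 M : R, 0 < M & forall u t, sphere u -> a <= t <= b -> `|dt Phi u t| <= M.
  have [ab|ab] := leP a b; last first.
    by exists 1 => // u t _ /andP[t1 t2]; have := le_trans t1 t2; rewrite leNgt ab.
  have [u su] := sphere_neq0 (R := R) n0.
  have [|p] := compact_EVT_max _ cAB cd.
    by exists (u, a); split => //=; rewrite in_itv/= lexx.
  rewrite inE => _ H; exists (`|dt Phi p.1 p.2| + 1); first by rewrite ltr_wpDl.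
  move=> v t sv vt; apply: (@le_trans _ _ `|dt Phi p.1 p.2|); last by rewrite lerDl.
  by apply: (H (v, t)); rewrite inE; split => //=; rewrite in_itv.
exists M => // u s t su sab tab; split; last exact: HM.
have /andP[s1 s2] := sab; have /andP[t1 t2] := tab.
have [||c /andP[c1 c2] ->] := @classC_mean_value u s t su.
- exact: lt_le_trans s1.
- exact: lt_le_trans t1.
rewrite normrM ler_wpM2r// HM// (le_trans _ c1) ?le_min ?s1//.
by rewrite (le_trans c2)// ge_max s2.
Qed.

(** With f = q the inverse is the radial function of the body, with f = h that of its polar; these
    give A and B. *)
Definition energy (nu : {measure set (Rn R n) -> \bar R}) (f : V -> R) : R :=
  \int[nu]_(u in (sphere : set (Rn R n))) Phi u (f u)^-1.

Lemma continuous_within_classC f : pos_cont f ->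
  {within sphere, continuous (fun u => Phi u (f u))}.
Proof. by move=> pf; apply: continuous_within_graph => //; exact: C.2.1. Qed.

Lemma continuous_within_dt f : pos_cont f ->
  {within sphere, continuous (fun u => dt Phi u (f u))}.
Proof. by move=> pf; apply: continuous_within_graph => //; exact: C.2.2. Qed.

End ClassC.

(** * Finite measures on the sphere and integrability *)

Section SphericalMeasures.
Context {R : realType} {n : nat} (n0 : (0 < n)%N).
Local Notation V := 'rV[R]_n.
Context (nu : {measure set (Rn R n) -> \bar R}) (snu : sph_measure nu).

Lemma sph_measure_sphere : nu (sphere : set (Rn R n)) = nu setT.
Proof.
have [nuC _] := snu; rewrite -(setUv (sphere : set (Rn R n))) measureU//.
- by rewrite -[LHS]adde0; congr (_ + _)%E; exact/esym.
- exact: measurable_sphere.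
- by apply: measurableC; exact: measurable_sphere.
- exact: setICr.
Qed.

Lemma sph_measure_fin : (nu (sphere : set (Rn R n)) < +oo)%E.
Proof. by rewrite sph_measure_sphere; case: snu => _ []. Qed.

Lemma sph_measure_gt0 : 0 < fine (nu (sphere : set (Rn R n))).
Proof.
by rewrite fine_gt0// sph_measure_fin sph_measure_sphere; case: snu => _ [->].
Qed.

Lemma within_continuous_bounded (f : V -> R) : {within sphere, continuous f} ->
  exists2 M : R, 0 <= M & forall u, sphere u -> `|f u| <= M.
Proof.
move=> cf.
have cn : {within sphere, continuous (fun u => `|f u|)}.
  by move=> x; apply: cvg_norm; exact: cf.
have [c _ H] := compact_EVT_max (sphere_neq0 n0) compact_sphere cn.
by exists `|f c| => // u su; apply: H; rewrite inE.
Qed.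

Lemma sph_integrable (f : V -> R) : {within sphere, continuous f} ->
  nu.-integrable (sphere : set (Rn R n)) (EFin \o f).
Proof.
move=> cf; have [M _ HM] := within_continuous_bounded cf.
apply: (@integrable_bounded_by _ (Rn R n) R nu sphere _ _ f M) => //.
- exact: measurable_sphere.
- exact: sph_measure_fin.
- by apply: measurable_fun_within_continuous => //; exact: measurable_sphere.
Qed.

End SphericalMeasures.

(** * Energy bounds *)

Lemma norm_pos_part_sub {R : realDomainType} (a b : R) :
  `|Num.max a 0 - Num.max b 0| <= `|a - b|.
Proof.
by rewrite !maxEle; case: ifPn => ?; case: ifPn => ?; rewrite ler_norml;
  apply/andP; split; case: (ger0P (a - b)); lra.
Qed.

Section HemisphereMass.
Context {R : realType} {n : nat} (n0 : (0 < n)%N).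
Local Notation V := 'rV[R]_n.
Context (nu : {measure set (Rn R n) -> \bar R}) (snu : sph_measure nu).

Lemma continuous_dotv_pos (v : V) : continuous (fun xi => Num.max (dotv v xi) 0).
Proof.
move=> x; apply: continuous_max => //; first exact: continuous_dotvr.
exact: cst_continuous.
Qed.

Lemma sph_integrable_dotv_pos (v : V) :
  nu.-integrable (sphere : set (Rn R n)) (fun xi => (Num.max (dotv v xi) 0)%:E).
Proof.
apply: (sph_integrable n0 snu); apply: continuous_subspaceT.
exact: continuous_dotv_pos.
Qed.

(** The integral is Lipschitz in [v], so it attains its minimum on the compact sphere, and that
    minimum is positive. *)
Lemma hemisphere_mass_ge : not_conc_hemisphere nu -> exists2 m : R, 0 < m &
  forall v, sphere v -> m <= \int[nu]_(xi in (sphere : set (Rn R n))) Num.max (dotv v xi) 0.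
Proof.
move=> nc; pose phi (v : V) := \int[nu]_(xi in (sphere : set (Rn R n))) Num.max (dotv v xi) 0.
have mS := @measurable_sphere R n.
have phi_lip v w : `|phi v - phi w| <= n%:R * fine (nu (sphere : set (Rn R n))) * `|v - w|.
  rewrite /phi -RintegralB//; try exact: sph_integrable_dotv_pos.
  apply: le_trans (le_normr_Rintegral _ _) _ => //.
    exact: (integrableB mS (sph_integrable_dotv_pos v) (sph_integrable_dotv_pos w)).
  rewrite mulrAC -Rintegral_cst//; apply: le_Rintegral => //.
  - apply: integrable_norm.
    exact: (integrableB mS (sph_integrable_dotv_pos v) (sph_integrable_dotv_pos w)).
  - apply: (sph_integrable n0 snu) => x; exact: cvg_cst.
  - move=> xi sx; have : `|dotv (v - w) xi| <= n%:R * `|v - w| by rewrite dotvC; exact: norm_dotv.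
    apply: le_trans; rewrite dotvBl.
    exact: norm_pos_part_sub.
have cphi : {within sphere, continuous phi}.
  by apply: continuous_subspaceT; exact: lipschitz_continuous phi_lip.
have [v] := compact_EVT_min (sphere_neq0 n0) compact_sphere cphi.
rewrite inE => sv H; exists (phi v); last by move=> w sw; apply: H; rewrite inE.
have := nc v sv; rewrite /phi /Rintegral => h.
have fi : (\int[nu]_(x in (sphere : set (Rn R n))) (Num.max (dotv v x) 0)%:E)%E \is a fin_num.
  by apply: integrable_fin_num => //; exact: sph_integrable_dotv_pos.
by rewrite fine_gt0// h/= ltey_eq fi.
Qed.

End HemisphereMass.

Section LowerBound.
Context {R : realType} {n : nat} (n0 : (0 < n)%N).
Local Notation V := 'rV[R]_n.
Context (Phi : V -> R -> R) (Cd : classCd Phi).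
Context (blow : forall xi, sphere xi -> Phi xi t @[t --> 0^'+] --> +oo).
Context (nu : {measure set (Rn R n) -> \bar R}) (snu : sph_measure nu).
Context (nc : not_conc_hemisphere nu).

Lemma classCd_decr u s t : sphere u -> 0 < s -> s <= t -> Phi u t <= Phi u s.
Proof.
move=> su s0 st; have t0 : 0 < t by exact: lt_le_trans st.
have [c cst e] := classC_mean_value Cd.1 su s0 t0.
rewrite -subr_le0 e mulr_le0_ge0 ?subr_ge0// ltW// Cd.2//.
by case/andP: cst => + _; rewrite min_l//; exact: lt_le_trans.
Qed.

(** A Dini-type argument: monotonicity in t carries a large value at one t1 to all smaller t,
    continuity carries it to nearby directions, and compactness does the rest. *)
Lemma uniform_blowup (N : R) : exists2 t0 : R, 0 < t0 &
  forall u t, sphere u -> 0 < t -> t <= t0 -> N <= Phi u t.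
Proof.
have /compact_near_coveringP cS := @compact_sphere R n.
have := cS R (0^'+) (fun t u => sphere u -> 0 < t -> N <= Phi u t) _.
case.
- move=> u su.
  (* The margin 1 pays for moving from [u] to a neighbouring direction. *)
  have [t1 [t10 Nt1]] : exists t1, 0 < t1 /\ N + 1 <= Phi u t1.
    have /cvgryPge/(_ (N + 1)) := blow su => H.
    near (0 : R)^'+ => t1; exists t1; split; near: t1; first exact: nbhs_right_gt.
    exact: H.
  have /subspace_continuousP/(_ u su) := continuous_within_classC Cd.1 (pos_cont_cst t10).
  move=> /cvgrPdist_lt/(_ 1 ltr01) H.
  exists ([set w | sphere w -> `|Phi u t1 - Phi w t1| < 1], [set t | t <= t1]).
    by split => //=; exact: nbhs_right_le.
  move=> [w t] /= [Hw tt1] sw tp.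
  by have := classCd_decr sw tp tt1; have := Hw sw; rewrite ltr_norml; lra.
- move=> t0 /= t00 H; exists (t0 / 2); first by rewrite divr_gt0.
  move=> u t su tp tt; apply: (H t) => //=; rewrite sub0r normrN gtr0_norm//.
  by rewrite (le_lt_trans tt)// ltr_pdivrMr// ltr_pMr// ltr1n.
Unshelve. all: by end_near. Qed.

(** If [a] is small, then 1 / q xi <= a / (v . xi) is small wherever v . xi > dl, so [Phi] is large
    there. Such directions carry a definite mass uniformly in [v], which contradicts the energy
    bound. In the application a = h v. *)
Lemma energy_lower_bound (c b : R) : exists2 e : R, 0 < e &
  forall q : V -> R, pos_cont q -> (forall xi, sphere xi -> - b <= Phi xi (q xi)^-1) ->
  energy Phi nu q <= c -> forall v a, sphere v -> 0 < a ->
  (forall xi, sphere xi -> dotv v xi <= a * q xi) -> e <= a.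
Proof.
have [m m0 Hm] := hemisphere_mass_ge n0 snu nc.
set S := fine (nu (sphere : set (Rn R n))); have S0 : 0 < S by exact: sph_measure_gt0.
(* With [dl] below, dl * S = m / 2, so N times the mass that remains, at least N * m / 2, equals |c
   + b S| + 1 or more and exceeds c + b S. *)
pose N := 2 * (`|c + b * S| + 1) / m.
have N0 : 0 < N by rewrite divr_gt0// mulr_gt0// ltr_wpDl.
pose dl := m / (2 * S); have dl0 : 0 < dl by rewrite divr_gt0// mulr_gt0.
have [t0 t00 Ht] := uniform_blowup (N - b).
exists (dl * t0); first exact: mulr_gt0.
move=> q pq qb qc v a sv a0 va; rewrite leNgt; apply/negP => adl.
have mS := @measurable_sphere R n.
have iPhi : nu.-integrable (sphere : set (Rn R n)) (EFin \o (fun xi => Phi xi (q xi)^-1)).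
  by apply: (sph_integrable n0 snu); exact: (continuous_within_classC Cd.1 (pos_contV pq)).
have icst (k : R) : nu.-integrable (sphere : set (Rn R n)) (EFin \o (fun=> k)).
  by apply: (sph_integrable n0 snu) => x; exact: cvg_cst.
have imax := sph_integrable_dotv_pos n0 snu v.
(* Pointwise, the left side is nonpositive when v . xi <= dl. Otherwise it is at most N, since v .
   xi <= 1, and N <= Phi + b by the blow-up. *)
have : \int[nu]_(xi in (sphere : set (Rn R n))) (N * (Num.max (dotv v xi) 0 - dl)) <=
       \int[nu]_(xi in (sphere : set (Rn R n))) (Phi xi (q xi)^-1 + b).
  apply: le_Rintegral => //.
  - exact: (integrableZl mS N (integrableB mS imax (icst dl))).
  - exact: (integrableD mS iPhi (icst b)).
  move=> xi sx; have q0 : 0 < q xi by case: pq => _; apply.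
  have vx1 := dotv_le1 sv sx; have := qb _ sx => bPhi.
  have [vd|vd] := leP (dotv v xi) dl.
    apply: (@le_trans _ _ 0); last by lra.
    rewrite mulr_ge0_le0 ?(ltW N0)// subr_le0 ge_max vd; exact: ltW.
  have v0 : 0 < dotv v xi by exact: lt_trans vd.
  have NP : N - b <= Phi xi (q xi)^-1.
    apply: Ht; rewrite ?invr_gt0//.
    rewrite -[(q xi)^-1]mul1r ler_pdivrMr//.
    have h1 := va _ sx.
    suff : dl < dl * (t0 * q xi) by rewrite -{1}[dl]mulr1 ltr_pM2l// => /ltW.
    apply: (lt_le_trans vd); apply: (le_trans h1).
    by rewrite mulrA ler_pM2r// ltW.
  rewrite max_l ?(ltW v0)//; apply: (@le_trans _ _ N); last by lra.
  rewrite ler_piMr ?(ltW N0)//; lra.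
rewrite RintegralZl//; last exact: (integrableB mS imax (icst dl)).
rewrite RintegralB// RintegralD// !Rintegral_cst// -/S.
rewrite -[\int[nu]_(x in _) Phi x _]/(energy Phi nu q) => H.
have h2 := Hm _ sv; have h3 := ler_norm (c + b * S).
have dlS : dl * S = m / 2 by rewrite /dl; field; rewrite gt_eqF.
have Nm : N * (m / 2) = `|c + b * S| + 1 by rewrite /N; field; rewrite gt_eqF.
have : N * (m / 2) <= c + b * S.
  apply: (@le_trans _ _ (energy Phi nu q + b * S)); last by lra.
  apply: le_trans H; rewrite ler_pM2l// dlS; lra.
rewrite Nm; lra.
Qed.

End LowerBound.

(** * Relaxed pairs and compactness *)

Lemma fmap_ultra (I T : Type) (f : I -> T) (U : set_system I) :
  UltraFilter U -> UltraFilter (f @ U).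
Proof.
move=> UU; have FU : ProperFilter U by exact: ultra_proper.
split=> [|G PG UG]; first exact: fmap_proper_filter.
apply/seteqP; split => // A GA.
have [//|UCA] := in_ultra_setVsetC (f @^-1` A) UU.
have GCA : G (~` A) by exact: UG.
have : G (A `&` ~` A) by apply: filterI.
by rewrite setICr => /(@filter_not_empty _ G PG).
Qed.

Section Energy.
Context {R : realType} {n : nat} (n0 : (0 < n)%N).
Local Notation V := 'rV[R]_n.
Context (nu : {measure set (Rn R n) -> \bar R}) (snu : sph_measure nu).
Context (Phi : V -> R -> R).

Lemma energy_integrable f : classC Phi -> pos_cont f ->
  nu.-integrable (sphere : set (Rn R n)) (EFin \o (fun xi => Phi xi (f xi)^-1)).
Proof.
move=> C pf; apply: (sph_integrable n0 snu).
exact: (continuous_within_classC C (pos_contV pf)).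
Qed.

Lemma energy_mono f g : classCd Phi -> pos_cont f -> pos_cont g ->
  (forall u, sphere u -> f u <= g u) -> energy Phi nu f <= energy Phi nu g.
Proof.
move=> Cd pf pg fg; apply: le_Rintegral.
- exact: measurable_sphere.
- exact: energy_integrable Cd.1 pf.
- exact: energy_integrable Cd.1 pg.
- move=> u su; have f0 : 0 < f u by case: pf => _; apply.
  have g0 : 0 < g u by case: pg => _; apply.
  by apply: (classCd_decr Cd su); rewrite ?invr_gt0// lef_pV2 ?posrE ?fg.
Qed.

Lemma energy_lipschitz (e : R) : classC Phi -> 0 < e -> exists2 L : R, 0 < L &
  forall f g d, pos_cont f -> pos_cont g ->
  (forall u, sphere u -> e <= f u <= e^-1) -> (forall u, sphere u -> e <= g u <= e^-1) ->
  (forall u, sphere u -> `|f u - g u| <= d) -> `|energy Phi nu f - energy Phi nu g| <= L * d.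
Proof.
move=> C e0; have [M M0 HM] := classC_lipschitz n0 C e^-1 e0.
have S0 := sph_measure_gt0 snu; have mS := @measurable_sphere R n.
exists (M * (e^-1 * e^-1) * fine (nu (sphere : set (Rn R n)))).
  by rewrite !mulr_gt0// invr_gt0.
move=> f g d pf pg fe ge fgd; rewrite /energy.
have iF := energy_integrable C pf; have iG := energy_integrable C pg.
rewrite -RintegralB//; apply: le_trans (le_normr_Rintegral _ _) _ => //.
  exact: (integrableB mS iF iG).
rewrite mulrAC -Rintegral_cst//; apply: le_Rintegral => //.
- by apply: integrable_norm; exact: (integrableB mS iF iG).
- by apply: (sph_integrable n0 snu) => x; exact: cvg_cst.
move=> u su; have /andP[f1 f2] := fe _ su; have /andP[g1 g2] := ge _ su.
have f0 : 0 < f u by exact: lt_le_trans f1.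
have g0 : 0 < g u by exact: lt_le_trans g1.
have inv a : e <= a -> a <= e^-1 -> e <= a^-1 <= e^-1.
  move=> a1 a2; have a0 : 0 < a by exact: lt_le_trans a1.
  by rewrite -[X in X <= _]invrK !lef_pV2 ?posrE ?invr_gt0// a1 a2.
have [h _] := HM u (g u)^-1 (f u)^-1 su (inv _ g1 g2) (inv _ f1 f2).
apply: le_trans h _; rewrite -mulrA ler_pM2l//.
have -> : (f u)^-1 - (g u)^-1 = (g u - f u) * ((f u)^-1 * (g u)^-1).
  by field; rewrite !gt_eqF.
rewrite normrM mulrC distrC; apply: ler_pM => //; last exact: fgd.
rewrite gtr0_norm ?mulr_gt0 ?invr_gt0//.
by apply: ler_pM; rewrite ?invr_ge0 ?(ltW f0) ?(ltW g0)// lef_pV2 ?posrE.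
Qed.

End Energy.

Section Relaxation.
Context {R : realType} {n : nat} (n0 : (0 < n)%N).
Local Notation V := 'rV[R]_n.
Implicit Types h q f : V -> R.

(** The inequality half of duality; it passes to pointwise limits and is satisfied by every positive
    function together with its polar function. *)
Definition relaxed_pair h q := [/\ pos_cont h, pos_cont q &
  forall u xi, sphere u -> sphere xi -> dotv u xi <= h u * q xi].

Lemma relaxed_pair_sym h q : relaxed_pair h q -> relaxed_pair q h.
Proof.
move=> [ph pq hq]; split => // u xi su sx.
by rewrite dotvC mulrC; exact: hq.
Qed.

Lemma dual_pair_sym h q : dual_pair h q -> dual_pair q h.
Proof. by case. Qed.

Lemma dual_pair_relaxed h q : dual_pair h q -> relaxed_pair h q.
Proof. by move=> hq; case: (hq) => ph pq _ _; split => // u xi; exact: dual_pair_dotv_le. Qed.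

Lemma continuous_polar_fun f : pos_cont f -> continuous (polar_fun f).
Proof.
move=> pf; have [e e0 ef] := pos_cont_ge n0 pf.
exact: lipschitz_continuous (polar_fun_lipschitz n0 pf e0 ef).
Qed.

(** The bipolar of [h] and the polar of [h] lie below [h] and [q]. By [energy_mono] the replacement
    lowers both energies, so relaxed competitors give the same infimum. *)
Lemma relaxed_pair_improve h q : relaxed_pair h q -> exists h' q',
  [/\ dual_pair h' q', continuous h', continuous q',
     forall u, sphere u -> h' u <= h u & forall u, sphere u -> q' u <= q u].
Proof.
move=> [ph pq hq]; have pp := pos_cont_polar_fun n0 ph; have ppp := pos_cont_polar_fun n0 pp.
exists (polar_fun (polar_fun h)), (polar_fun h); split => //.
- by split => // xi sx; rewrite polar_funKK.
- exact: continuous_polar_fun.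
- exact: continuous_polar_fun.
- by move=> u su; exact: polar_funK_le.
- by move=> u su; apply: polar_fun_le => // v sv; rewrite mulrC; exact: hq.
Qed.

(** An Arzela-Ascoli theorem in ultrafilter form: [U] yields limits at all points at once, without a
    diagonal subsequence, and the common Lipschitz constant with compactness makes the convergence
    uniform. *)
Lemma ultra_limit (U : set_system nat) (f_ : nat -> V -> R) (e L : R) :
  UltraFilter U -> 0 < e -> (forall k u, sphere u -> e <= f_ k u <= e^-1) ->
  (forall k x y, sphere x -> sphere y -> `|f_ k x - f_ k y| <= L * `|x - y|) ->
  exists f, [/\ pos_cont f, forall u, sphere u -> e <= f u <= e^-1,
    forall u, sphere u -> f_ k u @[k --> U] --> f u &
    forall d : R, 0 < d -> \forall k \near U, forall u, sphere u -> `|f_ k u - f u| < d].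
Proof.
move=> UU e0 fe fL.
have FU : ProperFilter U by exact: ultra_proper.
have lim u : exists l : R, sphere u -> f_ k u @[k --> U] --> l /\ e <= l <= e^-1.
  have [su|nsu] := pselect (sphere u); last by exists 0.
  have cI := @segment_compact R e e^-1; rewrite compact_ultra /= in cI.
  have UfU := fmap_ultra (fun k => f_ k u) UU.
  have [|l [/=]] := cI _ UfU.
    by apply: (@filterE _ U) => k; rewrite /= in_itv/=; exact: fe.
  by rewrite in_itv/= => le lU; exists l.
have [f Hf] := choice lim.
have fl u : sphere u -> f_ k u @[k --> U] --> f u by move=> /Hf[].
have fb u : sphere u -> e <= f u <= e^-1 by move=> /Hf[].
have L0 : 0 < `|L| + 1 by rewrite ltr_wpDl.
have fLip x y : sphere x -> sphere y -> `|f x - f y| <= (`|L| + 1) * `|x - y|.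
  move=> sx sy; have : `|f_ k x - f_ k y| @[k --> U] --> `|f x - f y|.
    by apply: cvg_norm; apply: cvgB; exact: fl.
  move=> /cvgr_to_le; apply; apply: nearW => k; apply: le_trans (fL k _ _ sx sy) _.
  by rewrite ler_wpM2r// (le_trans (ler_norm L))// lerDl.
exists f; split => //.
  split; last by move=> u /fb/andP[fu _]; exact: lt_le_trans fu.
  apply/subspace_continuousP => x sx; apply/cvgrPdist_lt => d d0.
  near=> y; apply: le_lt_trans (fLip _ _ sx _) _.
    by near: y; exact: withinT.
  rewrite mulrC -ltr_pdivlMr//; near: y; apply: cvg_within.
  by apply: (@cvgr_dist_lt _ _ _ _ (nbhs_filter x) id); [exact: cvg_id|exact: divr_gt0].
move=> d d0.
have /compact_near_coveringP cS := @compact_sphere R n.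
suff /cS : forall x : V, sphere x -> \forall x' \near x & k \near U,
    sphere x' -> `|f_ k x' - f x'| < d.
  by apply: filterS => k H u su; exact: H.
move=> x sx.
exists ([set y | `|x - y| < d / 3 / (`|L| + 1)], [set k | `|f_ k x - f x| < d / 3]).
  split => /=.
    by apply: (@cvgr_dist_lt _ _ _ _ (nbhs_filter x) id); [exact: cvg_id|rewrite !divr_gt0].
  by have /cvgr_distC_lt := fl _ sx; apply; rewrite divr_gt0.
move=> [y k] /= [xy kx] sy.
rewrite ltr_pdivlMr// mulrC in xy.
have h1 := fLip _ _ sx sy.
have h2 : `|f_ k y - f_ k x| <= (`|L| + 1) * `|x - y|.
  apply: le_trans (fL k _ _ sy sx) _; rewrite distrC.
  by rewrite ler_wpM2r// (le_trans (ler_norm L))// lerDl.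
have -> : f_ k y - f y = (f_ k y - f_ k x) + (f_ k x - f x) + (f x - f y) by ring.
apply: le_lt_trans (ler_normD _ _) _.
apply: le_lt_trans (_ : _ <= `|f_ k y - f_ k x| + `|f_ k x - f x| + `|f x - f y|) _.
  by rewrite lerD2r ler_normD.
lra.
Unshelve. all: by end_near. Qed.

End Relaxation.

Section Minimizer.
Context {R : realType} {n : nat} (n0 : (0 < n)%N).
Local Notation V := 'rV[R]_n.
Implicit Types h q f : V -> R.

(* The pair minimises the larger of the two energies.  Bounding both from above
   bounds both functions below, by [energy_lower_bound] applied first to the
   positive integrand and then to the other one. *)
Lemma exists_minimal_pair_pos (G Psi : V -> R -> R) (lam mu : {measure set (Rn R n) -> \bar R}) :
  sph_measure lam -> not_conc_hemisphere lam ->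
  sph_measure mu -> not_conc_hemisphere mu ->
  classCd G -> (forall xi, sphere xi -> G xi t @[t --> 0^'+] --> +oo) ->
  classCd Psi -> (forall xi, sphere xi -> Psi xi t @[t --> 0^'+] --> +oo) ->
  (forall u t, sphere u -> 0 < t -> 0 < G u t) ->
  exists h q, [/\ dual_pair h q, continuous h, continuous q &
    forall h' q', relaxed_pair h' q' ->
      ~ (energy G lam q' < energy G lam q /\ energy Psi mu h' < energy Psi mu h)].
Proof.
move=> slam nlam smu nmu CG bG CP bP G0.
pose val (h q : V -> R) := Num.max (energy G lam q) (energy Psi mu h).
pose E := [set val hq.1 hq.2 | hq in [set hq : (V -> R) * (V -> R) | dual_pair hq.1 hq.2]].
have pos h : pos_cont h -> 0 <= energy G lam h.
  move=> [_ ph]; apply: Rintegral_ge0 => u su; apply/ltW/G0 => //.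
  by rewrite invr_gt0 ph.
have r1 : relaxed_pair (fun _ : V => 1 : R) (fun _ => 1).
  by split; try exact: pos_cont_cst; move=> u xi su sx; rewrite mulr1; exact: dotv_le1.
have E0 : E !=set0.
  have [h [q [hq _ _ _ _]]] := relaxed_pair_improve n0 r1.
  by exists (val h q), (h, q).
have Elb : has_lbound E.
  by exists 0 => _ [[h q] /= hq <-]; rewrite le_max pos//; case: hq.
have infE : has_inf E by split.
pose m := inf E.
have valm h q : relaxed_pair h q -> m <= val h q.
  move=> /[dup] hq /(relaxed_pair_improve n0)[h' [q' [hq' _ _ hh qq]]].
  apply: (@le_trans _ _ (val h' q')); first by apply: ge_inf => //; exists (h', q').
  have [[ph pq _] [ph' pq' _ _]] := (hq, hq').
  by rewrite /val ge_max !le_max !(energy_mono n0)// orbT.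
have [e e0 He] : exists2 e : R, 0 < e & forall h q, dual_pair h q -> val h q <= m + 1 ->
    forall u, sphere u -> e <= h u <= e^-1 /\ e <= q u <= e^-1.
  have [e1 e10 H1] := energy_lower_bound n0 CG bG slam nlam (m + 1) 0.
  (* Once h >= e1, the argument 1 / h is at most 1 / e1, so the decreasing [Psi] is at least its
     value there. This lower bound stands in for positivity. *)
  have [b Hb] : exists b : R, forall u, sphere u -> - b <= Psi u e1^-1.
    have [M _ HM] := within_continuous_bounded n0 (continuous_within_classC CP.1 (pos_contV (pos_cont_cst e10))).
    by exists M => u /HM; rewrite ler_norml => /andP[].
  have [e2 e20 H2] := energy_lower_bound n0 CP bP smu nmu (m + 1) b.
  exists (Num.min e1 e2); first by rewrite lt_min e10.
  move=> h q hq; rewrite /val ge_max => /andP[hG hP] u su.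
  have [ph pq hE qE] := hq; have rhq := dual_pair_relaxed n0 hq.
  have he1 v : sphere v -> e1 <= h v.
    move=> sv; apply: (H1 q pq _ hG v) => //.
    - move=> xi sx; rewrite oppr0; apply/ltW/G0 => //; rewrite invr_gt0.
      by case: pq => _; apply.
    - by case: ph => _; apply.
    - by move=> xi sx; case: rhq => _ _; apply.
  have qe2 v : sphere v -> e2 <= q v.
    move=> sv; apply: (H2 h ph _ hP v) => //.
    - move=> xi sx; apply: le_trans (Hb _ sx) _.
      have h0 : 0 < h xi by case: ph => _; apply.
      by apply: (classCd_decr CP sx); rewrite ?invr_gt0// lef_pV2 ?posrE ?he1.
    - by case: pq => _; apply.
    - by move=> xi sx; rewrite dotvC mulrC; case: rhq => _ _; apply.
  set e := Num.min e1 e2; have e0 : 0 < e by rewrite lt_min e10.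
  have he v : sphere v -> e <= h v by move=> /he1; apply: le_trans; rewrite ge_min lexx.
  have qe v : sphere v -> e <= q v by move=> /qe2; apply: le_trans; rewrite ge_min lexx orbT.
  have polar_le f : pos_cont f -> (forall v, sphere v -> e <= f v) -> polar_fun f u <= e^-1.
    move=> pf fe; apply: (polar_fun_le n0 pf) => v sv; apply: le_trans (dotv_le1 sv su) _.
    by rewrite mulrC ler_pdivlMr// mul1r fe.
  by rewrite he// qe//= hE// qE// !polar_le.
have near_inf (k : nat) : exists hq : (V -> R) * (V -> R),
    dual_pair hq.1 hq.2 /\ val hq.1 hq.2 < m + k.+1%:R^-1.
  have k0 : 0 < k.+1%:R^-1 :> R by rewrite invr_gt0.
  by have [_ [hq hq1 <-] hq2] := inf_adherent k0 infE; exists hq.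
have [hq_ Hhq] := choice near_inf.
have Hb k u : sphere u -> e <= (hq_ k).1 u <= e^-1 /\ e <= (hq_ k).2 u <= e^-1.
  have [d1 d2] := Hhq k; apply: (He _ _ d1); apply: ltW; apply: lt_le_trans d2 _.
  by rewrite lerD2l invf_le1// ler1n.
have [U [UU ooU]] := ultraFilterLemma (@eventually_filter).
have FU : ProperFilter U by exact: ultra_proper.
(* Each member of a dual pair is the polar function of the other, which is at least [e]; hence one
   Lipschitz constant serves the whole sequence. *)
have lip f g : dual_pair f g -> (forall u, sphere u -> e <= g u) ->
    forall x y, sphere x -> sphere y -> `|f x - f y| <= n%:R / e * `|x - y|.
  move=> [pf pg fE _] ge x y sx sy; rewrite !fE//; exact: polar_fun_lipschitz.
have [h [ph hb hl hu]] : exists f, [/\ pos_cont f, forall u, sphere u -> e <= f u <= e^-1,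
    forall u, sphere u -> (hq_ k).1 u @[k --> U] --> f u &
    forall d : R, 0 < d -> \forall k \near U, forall u, sphere u -> `|(hq_ k).1 u - f u| < d].
  apply: (ultra_limit (L := n%:R / e) UU e0) => [k u su|k]; first by case: (Hb k _ su).
  by apply: (lip _ _ (Hhq k).1) => u /(Hb k)[_ /andP[]].
have [q [pq qb ql qu]] : exists f, [/\ pos_cont f, forall u, sphere u -> e <= f u <= e^-1,
    forall u, sphere u -> (hq_ k).2 u @[k --> U] --> f u &
    forall d : R, 0 < d -> \forall k \near U, forall u, sphere u -> `|(hq_ k).2 u - f u| < d].
  apply: (ultra_limit (L := n%:R / e) UU e0) => [k u su|k]; first by case: (Hb k _ su).
  by apply: (lip _ _ (dual_pair_sym (Hhq k).1)) => u /(Hb k)[/andP[]].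
have rhq : relaxed_pair h q.
  split => // u xi su sx.
  have : (hq_ k).1 u * (hq_ k).2 xi @[k --> U] --> h u * q xi.
    by apply: cvgM; [exact: hl|exact: ql].
  move=> /cvgr_to_ge; apply; apply: nearW => k.
  by have [_ _] := dual_pair_relaxed n0 (Hhq k).1; exact.
have small (d : R) : 0 < d -> \forall k \near U, k.+1%:R^-1 < d.
  move=> d0; apply: ooU; near=> k.
  have kd : d^-1 < k%:R by near: k; exact: nbhs_infty_gtr.
  rewrite -[d]invrK ltf_pV2 ?posrE ?invr_gt0//; apply: lt_trans kd _.
  by rewrite ltr_nat.
have energy_le (Phi : V -> R -> R) (nu : {measure set (Rn R n) -> \bar R})
    (f_ : nat -> V -> R) f : sph_measure nu -> classC Phi ->
    (forall k, pos_cont (f_ k)) -> pos_cont f ->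
    (forall k u, sphere u -> e <= f_ k u <= e^-1) -> (forall u, sphere u -> e <= f u <= e^-1) ->
    (forall d : R, 0 < d -> \forall k \near U, forall u, sphere u -> `|f_ k u - f u| < d) ->
    (forall k, energy Phi nu (f_ k) <= m + k.+1%:R^-1) -> energy Phi nu f <= m.
  move=> snu C pf_ pf fb_ fb fu fm.
  have [L L0 HL] := energy_lipschitz n0 snu C e0.
  apply/ler_addgt0Pr => d d0.
  have dL : 0 < d / 2 / L by rewrite !divr_gt0.
  near U => k.
  have fk : forall u, sphere u -> `|f_ k u - f u| < d / 2 / L by near: k; exact: fu.
  have kd : k.+1%:R^-1 < d / 2 by near: k; apply: small; rewrite divr_gt0.
  have := HL _ _ (d / 2 / L) (pf_ k) pf (fb_ k) fb (fun u su => ltW (fk u su)).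
  have -> : L * (d / 2 / L) = d / 2 by field; rewrite gt_eqF.
  rewrite ler_norml => /andP[h1 h2]; move: kd (fm k); move: (k.+1%:R^-1) => i; lra.
have mG : energy G lam q <= m.
  apply: (energy_le G lam (fun k => (hq_ k).2)) => //.
  - exact: CG.1.
  - by move=> k; case: (Hhq k) => -[].
  - by move=> k u /(Hb k)[].
  - by move=> k; have [_ /ltW] := Hhq k; rewrite ge_max => /andP[].
have mP : energy Psi mu h <= m.
  apply: (energy_le Psi mu (fun k => (hq_ k).1)) => //.
  - exact: CP.1.
  - by move=> k; case: (Hhq k) => -[].
  - by move=> k u /(Hb k)[].
  - by move=> k; have [_ /ltW] := Hhq k; rewrite ge_max => /andP[].
(* The limit is known only as a relaxed pair; its dual improvement still has both energies at most
   [m], so lowering both would put [val] below the infimum. *)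
have [h' [q' [hq' ch cq hh qq]]] := relaxed_pair_improve n0 rhq.
exists h', q'; split => // h2 q2 r2 [].
have [ph' pq' _ _] := hq'.
have /(_ _ _ r2) := valm; rewrite /val le_max => /orP[] m2 l1 l2.
  have : energy G lam q' <= energy G lam q by exact: energy_mono.
  lra.
have : energy Psi mu h' <= energy Psi mu h by exact: energy_mono.
lra.
Unshelve. all: by end_near. Qed.

Lemma exists_minimal_pair (G Psi : V -> R -> R) (lam mu : {measure set (Rn R n) -> \bar R}) :
  sph_measure lam -> not_conc_hemisphere lam ->
  sph_measure mu -> not_conc_hemisphere mu ->
  classCd G -> (forall xi, sphere xi -> G xi t @[t --> 0^'+] --> +oo) ->
  classCd Psi -> (forall xi, sphere xi -> Psi xi t @[t --> 0^'+] --> +oo) ->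
  (forall u t, sphere u -> 0 < t -> 0 < G u t) \/
  (forall u t, sphere u -> 0 < t -> 0 < Psi u t) ->
  exists h q, [/\ dual_pair h q, continuous h, continuous q &
    forall h' q', relaxed_pair h' q' ->
      ~ (energy G lam q' < energy G lam q /\ energy Psi mu h' < energy Psi mu h)].
Proof.
move=> slam nlam smu nmu CG bG CP bP [G0|P0]; first exact: exists_minimal_pair_pos.
have [q [h [qh cq ch H]]] := exists_minimal_pair_pos smu nmu slam nlam CP bP CG bG P0.
exists h, q; split => //; first exact: dual_pair_sym.
by move=> h' q' /relaxed_pair_sym /H H' [? ?]; apply: H'.
Qed.

End Minimizer.

(** * First variation *)

Section EnergyDerivative.
Context {R : realType} {n : nat} (n0 : (0 < n)%N).
Local Notation V := 'rV[R]_n.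
Implicit Types h q f g l : V -> R.

(** A chain rule along sequences. The mean value form never divides by y_k - y, which may vanish. *)
Lemma classC_cvg_slope (Phi : V -> R -> R) (u : V) (y : R) (y_ s_ : nat -> R) (l : R) :
  classC Phi -> sphere u -> 0 < y -> (forall k, 0 < y_ k) -> y_ k @[k --> \oo] --> y ->
  (y_ k - y) / s_ k @[k --> \oo] --> l ->
  (Phi u (y_ k) - Phi u y) / s_ k @[k --> \oo] --> dt Phi u y * l.
Proof.
move=> C su y0 y_0 yy sl.
have mv k : exists c, Num.min y (y_ k) <= c <= Num.max y (y_ k) /\
    Phi u (y_ k) - Phi u y = dt Phi u c * (y_ k - y).
  by have [c] := classC_mean_value C su y0 (y_0 k); exists c.
have [c Hc] := choice mv.
have cy : c k @[k --> \oo] --> y.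
  have ey k : `|c k - y| <= `|y_ k - y|.
    have [+ _] := Hc k; case: (leP y (y_ k)) => h /andP[h1 h2].
      by rewrite !ger0_norm ?subr_ge0//; lra.
    by rewrite !ler0_norm ?subr_le0 ?(ltW h)//; lra.
  apply/cvgrPdist_lt => d d0; have /cvgrPdist_lt/(_ d d0) := yy.
  by apply: filterS => k; rewrite ![`|y - _|]distrC; exact: le_lt_trans.
have dc : dt Phi u (c k) @[k --> \oo] --> dt Phi u y.
  have /subspace_continuousP/(_ (u, y) (conj su y0)) := C.2.2.
  move=> /cvgrPdist_lt H; apply/cvgrPdist_lt => d d0.
  have [[A B] [/= uA yB] AB] := H d d0.
  have yc : \forall k \near \oo, B (c k) by exact: cy.
  apply: filterS yc => k Bk; apply: (AB (u, c k)); first by split => //; exact: nbhs_singleton.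
  split => //=; have [/andP[+ _] _] := Hc k; apply: lt_le_trans.
  by rewrite lt_min y0 y_0.
have -> : (fun k => (Phi u (y_ k) - Phi u y) / s_ k) =
    (fun k => dt Phi u (c k) * ((y_ k - y) / s_ k)).
  by apply/funext => k; have [_ ->] := Hc k; rewrite mulrA.
exact: cvgM.
Qed.

(** Differentiation under the integral: [l] is the derivative of 1 / f off the null set [N], and the
    quotients are dominated by a Lipschitz constant of [Phi] on [a, b] times [K]. *)
Lemma energy_derivative (Phi : V -> R -> R) (nu : {measure set (Rn R n) -> \bar R})
    (N : set (Rn R n)) f (f_ : nat -> V -> R) (s_ : nat -> R) l (a b K : R) :
  classC Phi -> sph_measure nu -> measurable N -> nu N = 0%E ->
  pos_cont f -> (forall k, pos_cont (f_ k)) -> 0 < a ->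
  (forall k, 0 < s_ k) -> s_ k @[k --> \oo] --> 0 ->
  (forall u, sphere u -> a <= (f u)^-1 <= b) ->
  (forall k u, sphere u -> a <= (f_ k u)^-1 <= b) ->
  (forall k u, sphere u -> `|(f_ k u)^-1 - (f u)^-1| <= K * s_ k) ->
  (forall u, sphere u -> ~ N u -> ((f_ k u)^-1 - (f u)^-1) / s_ k @[k --> \oo] --> l u) ->
  (energy Phi nu (f_ k) - energy Phi nu f) / s_ k @[k --> \oo] -->
    \int[nu]_(u in (sphere `\` N : set (Rn R n))) (dt Phi u (f u)^-1 * l u).
Proof.
move=> C snu mN N0 pf pf_ a0 s0 sto0 fab fkab fK fl.
have mS := @measurable_sphere R n.
have mD : measurable (sphere `\` N : set (Rn R n)) by exact: measurableD.
have Dfin : (nu (sphere `\` N : set (Rn R n)) < +oo)%E.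
  apply: le_lt_trans (sph_measure_fin snu); apply: le_measure; [by rewrite inE|by rewrite inE|].
  exact: subDsetl.
have i_ k := energy_integrable n0 snu C (pf_ k).
have iF := energy_integrable n0 snu C pf.
pose D_ k u := (Phi u (f_ k u)^-1 - Phi u (f u)^-1) / s_ k.
have iB k : nu.-integrable (sphere : set (Rn R n)) (EFin \o (fun u => Phi u (f_ k u)^-1 - Phi u (f u)^-1)).
  exact: (integrableB mS (i_ k) iF).
have iD k : nu.-integrable (sphere : set (Rn R n)) (EFin \o D_ k).
  have -> : EFin \o D_ k = (fun u => (Phi u (f_ k u)^-1 - Phi u (f u)^-1)%:E * (s_ k)^-1%:E)%E by [].
  exact: (integrableZr mS (s_ k)^-1 (iB k)).
have -> : (fun k => (energy Phi nu (f_ k) - energy Phi nu f) / s_ k) =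
    (fun k => \int[nu]_(u in (sphere `\` N : set (Rn R n))) D_ k u).
  apply/funext => k; rewrite /energy -RintegralB// -RintegralZr//.
  by rewrite /Rintegral (negligible_integral mN mS (iD k) N0).
have [M M0 HM] := classC_lipschitz n0 C b a0.
apply: (cvg_Rintegral_bounded mD Dfin (M := M * K)).
- move=> k; apply: (measurable_funS mS); first by move=> x [].
  have /integrableP[/measurable_EFinP + _] := iD k; exact.
- move=> k u [su _]; rewrite /D_ normrM normfV (gtr0_norm (s0 k)) ler_pdivrMr//.
  have [h _] := HM _ _ _ su (fab _ su) (fkab k _ su).
  by apply: le_trans h _; rewrite -mulrA ler_pM2l// fK.
- move=> u [su Nu]; apply: classC_cvg_slope => //.
  + by rewrite invr_gt0; case: pf => _; apply.
  + by move=> k; rewrite invr_gt0; case: (pf_ k) => _; apply.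
  + apply/cvgrPdist_le => d d0.
    have Ks : K * s_ k @[k --> \oo] --> K * 0 by apply: cvgMr.
    rewrite mulr0 in Ks; have /cvgrPdist_le/(_ d d0) := Ks.
    apply: filterS => k; rewrite sub0r normrN distrC => h.
    by apply: le_trans (fK k _ su) _; apply: le_trans (ler_norm _) h.
  + exact: fl.
Qed.

End EnergyDerivative.

(** * Response of the gauge to a perturbed support function *)

Section Variation.
Context {R : realType} {n : nat} (n0 : (0 < n)%N).
Local Notation V := 'rV[R]_n.
Implicit Types u v xi : V.
Context (h q : V -> R) (hq : dual_pair h q).
Context (g : V -> R) (cg : {within sphere, continuous g}).
Context (M : R) (gM : forall u, sphere u -> `|g u| <= M).

Let ph : pos_cont h. Proof. by case: hq. Qed.
Let pq : pos_cont q. Proof. by case: hq. Qed.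
Let h0 u : sphere u -> 0 < h u. Proof. by case: ph => _; exact. Qed.
Let q0 u : sphere u -> 0 < q u. Proof. by case: pq => _; exact. Qed.

(** The perturbation sits in the denominator so that both 1 / h and the ratio u . xi / h u maximised
    by the polar function are multiplied by 1 + s g u, which is affine in s. *)
Definition perturb (s : R) u := h u / (1 + s * g u).

Let small_factor s u : 0 < s -> s * M <= 1 / 2 -> sphere u -> `|s * g u| <= 1 / 2.
Proof.
move=> s0 sM su; rewrite normrM gtr0_norm//; apply: le_trans sM.
by rewrite ler_pM2l// gM.
Qed.

Let factor_bounds s u : 0 < s -> s * M <= 1 / 2 -> sphere u -> 1 / 2 <= 1 + s * g u <= 3 / 2.
Proof. by move=> s0 sM su; have := small_factor s0 sM su; rewrite ler_norml; lra. Qed.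

Lemma pos_cont_perturb s : 0 < s -> s * M <= 1 / 2 -> pos_cont (perturb s).
Proof.
move=> s0 sM; have pp : pos_cont (fun u => 1 + s * g u).
  split; last by move=> u su; have := factor_bounds s0 sM su; lra.
  move=> x; apply: cvgD; first exact: cvg_cst.
  by apply: cvgMr; exact: cg.
split; last by move=> u su; rewrite divr_gt0 ?h0//; case: pp => _; apply.
apply: continuous_withinM; first by case: ph.
by case: (pos_contV pp).
Qed.

(** The old normal [u] is a competitor in the perturbed supremum. *)
Lemma polar_perturb_ge s u xi : 0 < s -> s * M <= 1 / 2 -> sphere u -> sphere xi ->
  dotv u xi = h u * q xi -> q xi * (1 + s * g u) <= polar_fun (perturb s) xi.
Proof.
move=> s0 sM su sx uE.
have := polar_fun_ge n0 xi (pos_cont_perturb s0 sM) su; rewrite /perturb uE.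
rewrite invf_div mulrA [h u * q xi]mulrC.
rewrite (_ : q xi * h u * _ / h u = q xi * (1 + s * g u))//.
by field; rewrite gt_eqF ?h0.
Qed.

(** Conversely, the perturbed maximiser is a competitor in the original supremum q xi. *)
Lemma polar_perturb_le s xi : 0 < s -> s * M <= 1 / 2 -> sphere xi ->
  exists2 u, sphere u & polar_fun (perturb s) xi = dotv u xi / h u * (1 + s * g u) /\
    polar_fun (perturb s) xi <= q xi * (1 + s * g u).
Proof.
move=> s0 sM sx.
have [u su [uE _]] := polar_fun_max n0 xi (pos_cont_perturb s0 sM).
have e : polar_fun (perturb s) xi = dotv u xi / h u * (1 + s * g u).
  by rewrite uE /perturb invf_div mulrA mulrAC.
exists u => //; split => //; rewrite e ler_wpM2r//.
  by have := factor_bounds s0 sM su; lra.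
by rewrite ler_pdivrMr ?h0// mulrC dual_pair_dotv_le.
Qed.

Lemma polar_perturb_bound s xi : 0 < s -> s * M <= 1 / 2 -> sphere xi ->
  `|polar_fun (perturb s) xi - q xi| <= q xi * (s * M).
Proof.
move=> s0 sM sx; have [u /(radial_gauss_wulffE n0 hq _ sx)[su uE]] := radial_gauss_wulff_neq0 n0 hq sx.
have := polar_perturb_ge s0 sM su sx uE.
have [v sv [_]] := polar_perturb_le s0 sM sx.
have gs w : sphere w -> - (s * M) <= s * g w <= s * M.
  by move=> sw; have := gM sw; rewrite ler_norml -mulrN !ler_pM2l.
have /andP[u1 u2] := gs _ su; have /andP[v1 v2] := gs _ sv; have qx := q0 sx.
rewrite ler_norml; move: (polar_fun _ _) => p h1 h2.
have : q xi * (1 + s * g v) <= q xi * (1 + s * M) by rewrite ler_pM2l// lerD2l.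
have : q xi * (1 - s * M) <= q xi * (1 + s * g u) by rewrite ler_pM2l// lerD2l.
by rewrite !mulrDr mulrN mulr1; lra.
Qed.

(* The directions where [g] exceeds [g u + d'] form a compact set on which the
   unperturbed ratio stays below its maximum [q xi], so for small [s] they contain
   no maximiser of the perturbed ratio. *)
Lemma cvg_polar_perturb_slope (s_ : nat -> R) xi u : sphere xi ->
  (forall k, 0 < s_ k) -> (forall k, s_ k * M <= 1 / 2) -> s_ k @[k --> \oo] --> 0 ->
  radial_gauss_set (wulff h) xi u ->
  (forall v, radial_gauss_set (wulff h) xi v -> u = v) ->
  (polar_fun (perturb (s_ k)) xi - q xi) / s_ k @[k --> \oo] --> q xi * g u.
Proof.
move=> sx s0 sM sto0 /(radial_gauss_wulffE n0 hq _ sx)[su uE] uniq; have qx := q0 sx.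
apply/cvgrPdist_le => d d0.
pose d' := d / q xi; have d'0 : 0 < d' by exact: divr_gt0.
pose F := [set v | sphere v /\ g u + d' <= g v].
have [eta eta0 Heta] : exists2 eta : R, 0 < eta & forall v, F v -> dotv v xi / h v <= q xi - eta.
  have [[v0 Fv0]|F0] := pselect (F !=set0); last first.
    by exists 1 => // v Fv; exfalso; apply: F0; exists v.
  have FS : F `<=` sphere by move=> v [].
  have cF : compact F.
    have cS : closed F.
      have /closed_subspaceP[W cW WS] : closed ((g : subspace sphere -> R) @^-1` [set t | g u + d' <= t]).
        by apply: preimage_closed; [move=> x _; exact: cg|exact: closed_ge].
      have -> : F = W `&` sphere by rewrite WS setIC.
      by apply: closedI => //; exact: closed_sphere.
    exact: subclosed_compact cS compact_sphere FS.
  have cr : {within F, continuous (fun v => dotv v xi / h v)}.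
    apply: (continuous_subspaceW FS); apply: continuous_withinM; last by case: (pos_contV ph).
    apply: continuous_subspaceT; apply: continuous_dotv => y; first exact: cvg_id.
    exact: cst_continuous.
  have [v] := compact_EVT_max (ex_intro _ v0 Fv0) cF cr.
  rewrite inE => -[sv gv] Hv; exists (q xi - dotv v xi / h v); last first.
    by move=> w Fw; rewrite subKr; apply: Hv; rewrite inE.
  rewrite subr_gt0 lt_neqAle; apply/andP; split.
    apply/eqP => e; have uv : u = v.
      apply: uniq; apply/(radial_gauss_wulffE n0 hq _ sx); split => //.
      by rewrite -e mulrC divfK// gt_eqF ?h0.
    by move: gv; rewrite -uv; lra.
  by rewrite ler_pdivrMr ?h0// mulrC dual_pair_dotv_le.
(* With t = q xi * s M, a maximiser in [F] would give at most q xi + t - eta / 2, the factor 1 + s g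
   being at least 1 / 2, whereas [u] gives at least q xi - t. This is absurd once 4 t < eta. *)
have small : \forall k \near \oo, s_ k * (4 * q xi * M) < eta.
  have : s_ k * (4 * q xi * M) @[k --> \oo] --> 0 * (4 * q xi * M) by apply: cvgMl.
  by rewrite mul0r => /cvgr_lt; apply.
apply: filterS small => k ks.
have sk := s0 k; have sMk := sM k.
have low := polar_perturb_ge sk sMk su sx uE.
have [v sv [vE vle]] := polar_perturb_le sk sMk sx.
have gv : g v < g u + d'.
  rewrite ltNge; apply/negP => Fv; have := Heta v (conj sv Fv).
  have gv := gM sv; have gu := gM su; move: gv gu; rewrite !ler_norml => /andP[gv1 gv2] /andP[gu1 gu2].
  have /andP[f1 f2] := factor_bounds sk sMk sv; move=> hv.
  have e0 : (q xi - eta) * (1 + s_ k * g v) <= q xi * (1 + s_ k * M) - eta / 2.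
    have e1 : q xi * (1 + s_ k * g v) <= q xi * (1 + s_ k * M).
      by rewrite ler_pM2l// lerD2l ler_pM2l.
    have e2 : eta * (1 / 2) <= eta * (1 + s_ k * g v) by rewrite ler_pM2l.
    by rewrite mulrBl; lra.
  have e3 : q xi * (1 - s_ k * M) <= q xi * (1 + s_ k * g u).
    by rewrite ler_pM2l// lerD2l -mulrN ler_pM2l.
  have e4 : dotv v xi / h v * (1 + s_ k * g v) <= (q xi - eta) * (1 + s_ k * g v).
    by rewrite ler_wpM2r//; lra.
  pose t := q xi * (s_ k * M).
  have t4 : 4 * t < eta by have -> : 4 * t = s_ k * (4 * q xi * M) by rewrite /t; ring.
  have q1 : q xi * (1 + s_ k * M) = q xi + t by rewrite /t; ring.
  have q2 : q xi * (1 - s_ k * M) = q xi - t by rewrite /t; ring.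
  rewrite q1 in e0; rewrite q2 in e3; rewrite vE in low.
  by have := le_trans e3 (le_trans low (le_trans e4 e0)); lra.
have up : (polar_fun (perturb (s_ k)) xi - q xi) / s_ k <= q xi * g u + d.
  rewrite ler_pdivrMr// lerBlDl; apply: le_trans vle _.
  have -> : q xi + (q xi * g u + d) * s_ k = q xi * (1 + s_ k * (g u + d')).
    by rewrite /d'; field; rewrite gt_eqF.
  by rewrite ler_pM2l// lerD2l ler_pM2l// ltW.
have dn : q xi * g u <= (polar_fun (perturb (s_ k)) xi - q xi) / s_ k.
  rewrite ler_pdivlMr// lerBrDl; apply: le_trans low.
  by rewrite le_eqVlt; apply/orP; left; apply/eqP; ring.
by rewrite ler_norml; move: up dn; move: (_ / s_ k) => r; lra.
Qed.

End Variation.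

(** * The Euler-Lagrange equation *)

Section Stationarity.
Context {R : realType} {n : nat} (n0 : (0 < n)%N).
Local Notation V := 'rV[R]_n.
Implicit Types (u v xi : V) (g : V -> R).
Context (G Psi : V -> R -> R) (CG : classCd G) (CP : classCd Psi).
Context (lam mu : {measure set (Rn R n) -> \bar R}).
Context (slam : sph_measure lam) (smu : sph_measure mu).
Context (h q : V -> R) (hq : dual_pair h q) (ch : continuous h) (cq : continuous q).
Context (N : set (Rn R n)) (mN : measurable N) (lamN : lam N = 0%E).
Context (uniqN : forall xi u v, sphere xi -> ~ N xi -> radial_gauss_set (wulff h) xi u ->
  radial_gauss_set (wulff h) xi v -> u = v).
Context (Hmin : forall h' q', relaxed_pair h' q' ->
  ~ (energy G lam q' < energy G lam q /\ energy Psi mu h' < energy Psi mu h)).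

Let ph : pos_cont h. Proof. by case: hq. Qed.
Let pq : pos_cont q. Proof. by case: hq. Qed.
Let h0 u : sphere u -> 0 < h u. Proof. by case: ph => _; exact. Qed.
Let q0 u : sphere u -> 0 < q u. Proof. by case: pq => _; exact. Qed.

Local Notation al := (radial_gauss (wulff h)).
Local Notation X := (sphere `\` N : set (Rn R n)).
Local Notation DG xi := (dt G xi (q xi)^-1 * (q xi)^-1).
Local Notation DP u := (dt Psi u (h u)^-1 * (h u)^-1).

Let mS : measurable (sphere : set (Rn R n)). Proof. exact: measurable_sphere. Qed.
Let mX : measurable X. Proof. exact: measurableD. Qed.

Let Xfin : (lam X < +oo)%E.
Proof.
apply: le_lt_trans (sph_measure_fin slam); apply: le_measure; [by rewrite inE|by rewrite inE|].
exact: subDsetl.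
Qed.

Lemma radial_gauss_sphere xi : sphere xi -> sphere (al xi).
Proof. by move=> /(radial_gauss_wulffP n0 hq)[]. Qed.

(** [al] is a choice made by [xget], so measurability must come from uniqueness on [X]: there the
    preimage of an open [U] is the complement of the directions having a normal outside [U], a
    projection of a compact set. *)
Lemma measurable_radial_gauss : measurable_fun X (al : Rn R n -> Rn R n).
Proof.
apply: (@measurability _ _ _ (Rn R n) _ _ (@open V)) => // _ [U oU <-].
pose C := [set p : V * V | [/\ sphere p.1, sphere p.2, (~` U) p.2 & dotv p.2 p.1 - h p.2 * q p.1 = 0]].
have cC : closed (fst @` C).
  apply: compact_closed; first exact: norm_hausdorff.
  apply: continuous_compact; first by apply: continuous_subspaceT => p; exact: cvg_fst.
  apply: (subclosed_compact _ (compact_setX (@compact_sphere R n) (@compact_sphere R n))).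
    have c1 : continuous (fun p : V * V => p.1) by move=> p; exact: cvg_fst.
    have c2 : continuous (fun p : V * V => p.2) by move=> p; exact: cvg_snd.
    have -> : C = (fst @^-1` sphere) `&` (snd @^-1` sphere) `&` (snd @^-1` (~` U)) `&`
        ((fun p : V * V => dotv p.2 p.1 - h p.2 * q p.1) @^-1` [set t | t = 0]).
      by apply/seteqP; split => [p [? ? ? ?]|p [[[? ?] ?] ?]].
    apply: closedI; [apply: closedI; [apply: closedI|]|].
    - by apply: preimage_closed; [move=> p _; exact: c1|exact: closed_sphere].
    - by apply: preimage_closed; [move=> p _; exact: c2|exact: closed_sphere].
    - by apply: preimage_closed; [move=> p _; exact: c2|exact: open_closedC].
    - apply: preimage_closed; last exact: closed_eq.
      move=> p _; apply: cvgB; first exact: (continuous_dotv c2 c1).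
      apply: cvgM.
        exact: (@continuous_comp _ _ _ snd h p (c2 p) (@ch p.2)).
      exact: (@continuous_comp _ _ _ fst q p (c1 p) (@cq p.1)).
  by move=> p [].
have -> : X `&` al @^-1` U = X `\` fst @` C.
  apply/seteqP; split => [xi [[sx Nx] Uxi]|xi [[sx Nx] nC]]; split => //.
    move=> [[y u] /= [_ su nU /eqP]]; rewrite subr_eq0 => /eqP uE yxi; subst y.
    apply: nU; suff -> : u = al xi by [].
    apply: uniqN Nx _ _ => //; first exact/(radial_gauss_wulffE n0 hq _ sx).
    exact/(radial_gauss_wulffE n0 hq _ sx)/(radial_gauss_wulffP n0 hq).
  apply: contrapT => nU; apply: nC; exists (xi, al xi) => //=.
  have [sa e] := radial_gauss_wulffP n0 hq sx.
  by split => //=; rewrite e subrr.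
by apply: measurableD => //; exact: measurable_closed_Rn.
Qed.

Lemma measurable_comp_radial_gauss g : {within sphere, continuous g} ->
  measurable_fun X (g \o al).
Proof.
move=> cg; apply: (measurable_comp mS).
- by move=> _ [xi [sx _] <-]; exact: radial_gauss_sphere.
- exact: measurable_fun_within_continuous.
- exact: measurable_radial_gauss.
Qed.

Lemma continuous_DG : {within sphere, continuous (fun xi => DG xi)}.
Proof.
by apply: continuous_withinM;
  [exact: (continuous_within_dt CG.1 (pos_contV pq))|case: (pos_contV pq)].
Qed.

Lemma continuous_DP : {within sphere, continuous (fun u => DP u)}.
Proof.
by apply: continuous_withinM;
  [exact: (continuous_within_dt CP.1 (pos_contV ph))|case: (pos_contV ph)].
Qed.

Lemma integrable_mul_radial_gauss (F : V -> R) g : {within sphere, continuous F} ->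
  {within sphere, continuous g} ->
  lam.-integrable X (EFin \o (fun xi => F xi * g (al xi))).
Proof.
move=> cF cg; have [A A0 HA] := within_continuous_bounded n0 cF.
have [B B0 HB] := within_continuous_bounded n0 cg.
apply: (integrable_bounded_by mX Xfin (M := A * B)).
  apply: measurable_funM; last exact: measurable_comp_radial_gauss.
  apply: (measurable_funS mS); first exact: subDsetl.
  exact: measurable_fun_within_continuous.
move=> xi [sx _]; rewrite normrM ler_pM ?HA//.
by apply: HB; exact: radial_gauss_sphere.
Qed.

(** To first order 1 / q changes by - s g(al) / q and 1 / h by + s g / h. The two signs therefore
    say that both energies strictly decrease for small s, against minimality. *)
Lemma no_descent_direction g : {within sphere, continuous g} ->
  ~ (0 < \int[lam]_(xi in X) (DG xi * g (al xi)) /\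
     \int[mu]_(u in (sphere : set (Rn R n))) (DP u * g u) < 0).
Proof.
move=> cg [IG JP].
have [M0 M00 gM0] := within_continuous_bounded n0 cg.
pose M := M0 + 1; have M_gt0 : 0 < M by rewrite ltr_wpDl.
have gM u : sphere u -> `|g u| <= M by move=> /gM0 /le_trans; apply; rewrite lerDl.
pose s_ (k : nat) : R := 1 / 2 / M / k.+1%:R.
have s0 k : 0 < s_ k by rewrite !divr_gt0.
have sM k : s_ k * M <= 1 / 2.
  have -> : s_ k * M = 1 / 2 / k.+1%:R.
    by rewrite /s_; field; rewrite !gt_eqF// addrC natr1.
  by rewrite ler_piMr ?invf_le1 ?ler1n ?divr_ge0.
have sto0 : s_ k @[k --> \oo] --> 0.
  have : (1 / 2 / M) * k.+1%:R^-1 @[k --> \oo] --> (1 / 2 / M) * 0.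
    by apply: cvgMr; exact: cvg_harmonic.
  by rewrite mulr0.
have [e3 e30 he3] := pos_cont_bounds n0 ph.
have [e4 e40 qe4] := pos_cont_bounds n0 pq.
(* The functions and their inverses lie in [e, 1 / e]. Perturbation changes them by factors between
   1 / 2 and 3 / 2, so [e / 2, 2 / e] contains everything below. *)
pose e := Num.min e3 e4; have e0 : 0 < e by rewrite lt_min e30.
have inv_e (a : R) : 0 < a -> e <= a -> e^-1 >= a^-1 by move=> a0 ea; rewrite lef_pV2.
have e3e : e3^-1 <= e^-1 by apply: inv_e => //; rewrite ge_min lexx.
have e4e : e4^-1 <= e^-1 by apply: inv_e => //; rewrite ge_min lexx orbT.
have vb (f : V -> R) (c : R) : 0 < c -> e <= c -> c^-1 <= e^-1 -> (forall u, sphere u -> c <= f u <= c^-1) ->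
    forall u, sphere u -> e <= (f u)^-1 <= e^-1.
  move=> c0 ec ce fc u su; have /andP[f1 f2] := fc _ su.
  have f0 : 0 < f u by exact: lt_le_trans f1.
  apply/andP; split; last by apply: inv_e => //; exact: le_trans f1.
  rewrite -[X in X <= _]invrK lef_pV2 ?posrE ?invr_gt0//.
  by apply: le_trans f2 _; apply: le_trans ce _; rewrite lexx.
have hb : forall u, sphere u -> e <= (h u)^-1 <= e^-1.
  by apply: (vb _ e3) => //; rewrite ge_min lexx.
have qb : forall u, sphere u -> e <= (q u)^-1 <= e^-1.
  by apply: (vb _ e4) => //; rewrite ge_min lexx orbT.
pose f_ k := perturb h g (s_ k); pose q_ k := polar_fun (f_ k).
have pf k : pos_cont (f_ k) by exact: (pos_cont_perturb hq cg gM (s0 k) (sM k)).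
have pqk k : pos_cont (q_ k) by exact: (pos_cont_polar_fun n0 (pf k)).
have ehalf : 0 < e / 2 by exact: divr_gt0.
have ei0 : 0 < e^-1 by rewrite invr_gt0.
have inv_wide (y : R) : e / 2 <= y <= 2 / e -> e / 2 <= y^-1 <= 2 / e.
  move=> /andP[y1 y2]; have y0 : 0 < y by apply: lt_le_trans y1; rewrite divr_gt0.
  have -> : e / 2 = (2 / e)^-1 by rewrite invf_div.
  have {2}-> : 2 / e = (e / 2)^-1 by rewrite invf_div.
  by rewrite !lef_pV2 ?posrE ?divr_gt0// y1 y2.
have inv_narrow (y : R) : 0 < y -> e <= y^-1 <= e^-1 -> e <= y <= e^-1.
  by move=> y0 /andP[y1 y2]; rewrite -lef_pV2 ?posrE// y2 -[y]invrK lef_pV2 ?posrE ?invr_gt0.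
have fE k u : sphere u -> (f_ k u)^-1 = (1 + s_ k * g u) * (h u)^-1.
  by move=> su; rewrite /f_ /perturb invf_div.
have sg k u : sphere u -> `|s_ k * g u| <= s_ k * M.
  by move=> su; rewrite normrM (gtr0_norm (s0 k)) ler_pM2l// gM.
have qkb k xi : sphere xi -> q xi / 2 <= q_ k xi <= 3 / 2 * q xi.
  move=> sx; have := polar_perturb_bound n0 hq cg gM (s0 k) (sM k) sx.
  rewrite -/(f_ k) -/(q_ k); have := q0 sx => qx.
  have : q xi * (s_ k * M) <= q xi * (1 / 2) by rewrite ler_pM2l.
  by rewrite ler_norml; lra.
have qdiff k xi : sphere xi -> (q_ k xi)^-1 - (q xi)^-1 = - ((q_ k xi - q xi) * (q_ k xi)^-1 * (q xi)^-1).
  move=> sx; have qx := q0 sx; have qk : 0 < q_ k xi by have := qkb k _ sx; lra.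
  by field; rewrite !gt_eqF.
have qkw k u : sphere u -> e / 2 <= (q_ k u)^-1 <= 2 / e.
  move=> su; apply: inv_wide; have qu := q0 su.
  have /andP[a1 a2] := inv_narrow _ qu (qb _ su); have /andP[a3 a4] := qkb k _ su.
  by apply/andP; split; lra.
have Alim := @energy_derivative R n n0 G lam N q q_ s_ (fun xi => - ((q xi)^-1 * g (al xi)))
  (e / 2) (2 / e) (2 * M / e) CG.1 slam mN lamN pq pqk.
have {Alim}Alim := Alim ehalf s0 sto0.
have {}Alim : (energy G lam (q_ k) - energy G lam q) / s_ k @[k --> \oo] -->
    \int[lam]_(xi in X) (dt G xi (q xi)^-1 * - ((q xi)^-1 * g (al xi))).
  apply: Alim.
  - by move=> u /qb/andP[u1 u2]; apply/andP; split; lra.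
  - exact: qkw.
  - move=> k u su; rewrite (qdiff _ _ su) normrN !normrM.
    have qu := q0 su; have /andP[w1 w2] := qkw k _ su.
    have qk : 0 < (q_ k u)^-1 by apply: lt_le_trans w1; rewrite divr_gt0.
    rewrite (gtr0_norm qk) (gtr0_norm (_ : 0 < (q u)^-1)) ?invr_gt0//.
    have b1 := polar_perturb_bound n0 hq cg gM (s0 k) (sM k) su.
    apply: (@le_trans _ _ (q u * (s_ k * M) * (q_ k u)^-1 * (q u)^-1)).
      by rewrite !ler_pM2r// invr_gt0.
    have -> : q u * (s_ k * M) * (q_ k u)^-1 * (q u)^-1 = s_ k * M * (q_ k u)^-1.
      by field; rewrite !gt_eqF// -invr_gt0.
    have -> : 2 * M / e * s_ k = s_ k * M * (2 / e) by ring.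
    by rewrite ler_pM2l// mulr_gt0.
  - move=> xi sx Nxi; have qx := q0 sx.
    have slope : (q_ k xi - q xi) / s_ k @[k --> \oo] --> q xi * g (al xi).
      have Ka := radial_gauss_wulffP n0 hq sx.
      apply: (cvg_polar_perturb_slope n0 hq cg gM sx s0 sM sto0).
        exact/(radial_gauss_wulffE n0 hq _ sx).
      move=> v Kv; apply: (uniqN sx Nxi _ Kv).
      exact/(radial_gauss_wulffE n0 hq _ sx).
    have qto : q_ k xi @[k --> \oo] --> q xi.
      have : q xi + (q_ k xi - q xi) / s_ k * s_ k @[k --> \oo] --> q xi + q xi * g (al xi) * 0.
        by apply: cvgD; [exact: cvg_cst|exact: cvgM].
      rewrite mulr0 addr0; apply: cvg_trans; apply: near_eq_cvg; apply: nearW => k.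
      by rewrite divfK ?gt_eqF// addrC subrK.
    have -> : (fun k => ((q_ k xi)^-1 - (q xi)^-1) / s_ k) =
        (fun k => - ((q_ k xi - q xi) / s_ k * (q_ k xi)^-1 * (q xi)^-1)).
      apply/funext => k; rewrite (qdiff _ _ sx).
      by move: (q_ k xi - _) (q_ k xi)^-1 (q xi)^-1 (s_ k)^-1 => x1 x2 x3 x4; ring.
    have -> : (q xi)^-1 * g (al xi) = q xi * g (al xi) * (q xi)^-1 * (q xi)^-1.
      by field; rewrite gt_eqF.
    apply: cvgN; apply: cvgM; last exact: cvg_cst.
    by apply: cvgM => //; apply: cvgV => //; rewrite gt_eqF.
have Blim : (energy Psi mu (f_ k) - energy Psi mu h) / s_ k @[k --> \oo] -->
    \int[mu]_(u in (sphere : set (Rn R n))) (dt Psi u (h u)^-1 * ((h u)^-1 * g u)).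
  (* For [mu] the exceptional set is empty: the quotient for 1 / h is constant in k at every
     direction. *)
  rewrite -[X in \int[mu]_(u in X) _]setD0.
  apply: (energy_derivative n0 CP.1 smu measurable0 (measure0 mu) ph pf ehalf s0 sto0
    (b := 2 / e) (K := 2 * M / e)).
  - by move=> u /hb/andP[u1 u2]; apply/andP; split; lra.
  - move=> k u su; rewrite fE//; have /andP[u1 u2] := hb _ su.
    have := le_trans (sg k _ su) (sM k); rewrite ler_norml => /andP[g1 g2].
    apply/andP; split.
      have -> : e / 2 = (1 / 2) * e by ring.
      by apply: ler_pM => //; lra.
    by apply: ler_pM => //; lra.
  - move=> k u su; rewrite fE//; have /andP[u1 u2] := hb _ su; have hu := h0 su.
    have -> : (1 + s_ k * g u) * (h u)^-1 - (h u)^-1 = s_ k * g u * (h u)^-1 by ring.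
    rewrite normrM (gtr0_norm (_ : 0 < (h u)^-1)) ?invr_gt0//.
    have -> : 2 * M / e * s_ k = s_ k * M * (2 / e) by ring.
    by apply: ler_pM => //; [rewrite invr_ge0 ltW|exact: sg|lra].
  - move=> u su _; have hu := h0 su.
    rewrite (_ : (fun k => _) = (fun=> (h u)^-1 * g u)); first exact: cvg_cst.
    by apply/funext => k; rewrite fE//; field; rewrite !gt_eqF.
have ev (u_ : nat -> R) (c l : R) : (u_ k - c) / s_ k @[k --> \oo] --> l -> l < 0 ->
    \forall k \near \oo, u_ k < c.
  move=> + l0; move=> /cvgr_lt/(_ _ l0); apply: filterS => k.
  by rewrite pmulr_llt0 ?invr_gt0// subr_lt0.
have evA := ev _ _ _ Alim; have evB := ev _ _ _ Blim.
have : \forall k \near \oo, energy G lam (q_ k) < energy G lam q /\ energy Psi mu (f_ k) < energy Psi mu h.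
  near=> k; split; near: k; [apply: evA|apply: evB].
  - rewrite (_ : (\int[lam]_(xi in X) _) = - (\int[lam]_(xi in X) (DG xi * g (al xi)))) ?oppr_lt0//.
    rewrite -mulN1r -RintegralZl//; last exact: (integrable_mul_radial_gauss continuous_DG cg).
    by apply: eq_Rintegral => xi _; ring.
  - by apply: le_lt_trans JP; rewrite le_eqVlt; apply/orP; left; apply/eqP; apply: eq_Rintegral => u _; rewrite mulrA.
move=> [k _ /(_ k (leqnn k))]; apply: Hmin; split => //.
by move=> u xi su sx; exact: dotv_le_polar_fun.
Unshelve. all: by end_near. Qed.

Lemma DG_lt0 xi : sphere xi -> DG xi < 0.
Proof. by move=> sx; rewrite nmulr_rlt0 ?invr_gt0 ?q0// CG.2// invr_gt0 q0. Qed.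

Lemma DP_lt0 u : sphere u -> DP u < 0.
Proof. by move=> su; rewrite nmulr_rlt0 ?invr_gt0 ?h0// CP.2// invr_gt0 h0. Qed.

Lemma measure_sphere_setD_null : lam X = lam (sphere : set (Rn R n)).
Proof.
rewrite [RHS](measureDI _ mS mN) (@subset_measure0 _ _ _ lam (sphere `&` N) N) ?adde0//.
exact: measurableI.
Qed.

Lemma Rintegral_lt0 (nu : {measure set (Rn R n) -> \bar R}) (D : set (Rn R n)) (F : V -> R) :
  measurable D -> D `<=` sphere -> (nu D < +oo)%E -> 0 < fine (nu D) ->
  {within sphere, continuous F} -> (forall u, sphere u -> F u < 0) ->
  \int[nu]_(u in D) F u < 0.
Proof.
move=> mD DS Dfin D0 cF F0.
have pF : pos_cont (fun u => - F u).
  split; last by move=> u su; rewrite oppr_gt0 F0.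
  by move=> x; apply: cvgN; exact: cF.
have [e e0 He] := pos_cont_ge n0 pF.
have [B _ HB] := within_continuous_bounded n0 cF.
apply: (@le_lt_trans _ _ (\int[nu]_(u in D) - e)).
  apply: le_Rintegral => //.
  - apply: (integrable_bounded_by mD Dfin (M := B)); last by move=> u /DS; exact: HB.
    by apply: (measurable_funS mS DS); exact: measurable_fun_within_continuous.
  - by apply: (integrable_bounded_by mD Dfin (M := `|- e|)).
  - by move=> u /DS /He; lra.
by rewrite Rintegral_cst// mulNr oppr_lt0 mulr_gt0.
Qed.

(** Both functionals are negative at the constant 1. If I g = 0 and J g < 0, subtracting a small
    constant from [g] yields a descent direction; so I g = 0 forces J g >= 0. Applying this to g - a
    and a - g with a = I g / I 1 gives J g = a J 1. *)
Lemma lagrange_multiplier : exists2 k : R, 0 < k & forall g, {within sphere, continuous g} ->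
  \int[lam]_(xi in X) (DG xi * g (al xi)) =
  k * \int[mu]_(u in (sphere : set (Rn R n))) (DP u * g u).
Proof.
pose I g := \int[lam]_(xi in X) (DG xi * g (al xi)).
pose J g := \int[mu]_(u in (sphere : set (Rn R n))) (DP u * g u).
have c1 : {within (sphere : set V), continuous (fun=> 1 : R)} by move=> x; exact: cvg_cst.
have iJ g : {within sphere, continuous g} ->
    mu.-integrable (sphere : set (Rn R n)) (EFin \o (fun u => DP u * g u)).
  by move=> cg; apply: (sph_integrable n0 smu); exact: continuous_withinM continuous_DP cg.
have iI g cg := integrable_mul_radial_gauss continuous_DG (g := g) cg.
have caff g (a b : R) : {within sphere, continuous g} ->
    {within sphere, continuous (fun u => a * g u + b)}.
  by move=> cg x; apply: cvgD; [apply: cvgMr; exact: cg|exact: cvg_cst].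
have Iaff g (a b : R) : {within sphere, continuous g} ->
    I (fun u => a * g u + b) = a * I g + b * I (fun=> 1).
  move=> cg; rewrite /I -!RintegralZl//; [|exact: (iI _ c1)|exact: (iI _ cg)].
  rewrite -RintegralD//; [|exact: (integrableZl mX a (iI _ cg))|exact: (integrableZl mX b (iI _ c1))].
  by apply: eq_Rintegral => xi _; ring.
have Jaff g (a b : R) : {within sphere, continuous g} ->
    J (fun u => a * g u + b) = a * J g + b * J (fun=> 1).
  move=> cg; rewrite /J -!RintegralZl//; [|exact: (iJ _ c1)|exact: (iJ _ cg)].
  rewrite -RintegralD//; [|exact: (integrableZl mS a (iJ _ cg))|exact: (integrableZl mS b (iJ _ c1))].
  by apply: eq_Rintegral => xi _; ring.
have I1 : I (fun=> 1) < 0.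
  rewrite /I (eq_Rintegral _ (g := fun xi : Rn R n => DG xi)); last by move=> xi _; rewrite mulr1.
  apply: (Rintegral_lt0 mX (@subDsetl _ sphere N) Xfin _ continuous_DG DG_lt0).
  by rewrite measure_sphere_setD_null; exact: sph_measure_gt0.
have J1 : J (fun=> 1) < 0.
  rewrite /J (eq_Rintegral _ (g := fun u : Rn R n => DP u)); last by move=> xi _; rewrite mulr1.
  exact: (Rintegral_lt0 mS _ (sph_measure_fin smu) (sph_measure_gt0 smu) continuous_DP DP_lt0).
have J_ge0 g : {within sphere, continuous g} -> I g = 0 -> 0 <= J g.
  move=> cg Ig; rewrite leNgt; apply/negP => Jg.
  (* Then J (g - e) = J g / 2 is still negative, while I (g - e) = - e * I 1 is positive. *)
  pose e := J g / (2 * J (fun=> 1)).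
  have e0 : 0 < e by rewrite /e nmulr_rgt0// invr_lt0 pmulr_rlt0.
  apply: (no_descent_direction (caff g 1 (- e) cg)).
  rewrite -/(I (fun u => 1 * g u + - e)) -/(J (fun u => 1 * g u + - e)) Iaff// Jaff// Ig.
  have -> : - e * J (fun=> 1) = - (J g / 2).
    by rewrite /e; field; rewrite lt_eqF.
  by split; [rewrite mulr0 add0r nmulr_rgt0 ?oppr_lt0|lra].
exists (I (fun=> 1) / J (fun=> 1)).
  by rewrite nmulr_rgt0// invr_lt0.
move=> g cg; rewrite -/(I g) -/(J g).
pose a := I g / I (fun=> 1).
have aI : a * I (fun=> 1) = I g by rewrite /a divfK// lt_eqF.
have Z1 : 0 <= J (fun u => 1 * g u + - a).
  by apply: J_ge0; [exact: caff|rewrite Iaff//; lra].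
have Z2 : 0 <= J (fun u => -1 * g u + a).
  by apply: J_ge0; [exact: caff|rewrite Iaff//; lra].
rewrite Jaff// in Z1; rewrite Jaff// in Z2.
have Jg : J g = a * J (fun=> 1) by lra.
by rewrite Jg -aI; field; rewrite lt_eqF.
Qed.

(** * From continuous test functions to Borel sets *)

Definition density xi := DG xi / DP (al xi).

Lemma continuous_invDP : {within sphere, continuous (fun u => (DP u)^-1)}.
Proof.
apply: continuous_withinV; first exact: continuous_DP.
by move=> u su; rewrite lt_eqF// DP_lt0.
Qed.

Lemma density_ge0 xi : sphere xi -> 0 <= density xi.
Proof.
move=> sx; rewrite /density mulr_le0// ?invr_le0 ltW ?DG_lt0 ?DP_lt0//.
exact: radial_gauss_sphere.
Qed.

Lemma measurable_density : measurable_fun X density.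
Proof.
apply: measurable_funM.
  apply: (measurable_funS mS); first exact: subDsetl.
  by apply: measurable_fun_within_continuous => //; exact: continuous_DG.
exact: (measurable_comp_radial_gauss continuous_invDP).
Qed.

Lemma density_bounded : exists2 B : R, 0 <= B & forall xi, sphere xi -> `|density xi| <= B.
Proof.
have [A A0 HA] := within_continuous_bounded n0 continuous_DG.
have [B B0 HB] := within_continuous_bounded n0 continuous_invDP.
exists (A * B); first exact: mulr_ge0.
by move=> xi sx; rewrite normrM ler_pM ?HA ?HB//; exact: radial_gauss_sphere.
Qed.

(** Up to the null set [N], the domain on the left is the reverse radial Gauss image of [om]; the
    identity thus says that C_Theta of [om] is k times its [mu] measure. *)
Definition balanced (k : R) (om : set (Rn R n)) :=
  (\int[lam]_(xi in X `&` al @^-1` om) (density xi)%:E = k%:E * mu (sphere `&` om))%E.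

(** The multiplier identity tested on g / DP, which is continuous because [DP] never vanishes on the
    sphere. *)
Lemma density_test : exists2 k : R, 0 < k & forall g, {within sphere, continuous g} ->
  \int[lam]_(xi in X) (density xi * g (al xi)) =
  k * \int[mu]_(u in (sphere : set (Rn R n))) g u.
Proof.
have [k k0 Hk] := lagrange_multiplier; exists k => // g cg.
have := Hk _ (continuous_withinM continuous_invDP cg).
rewrite (eq_Rintegral _ (g := fun xi : Rn R n => density xi * g (al xi))); last first.
  by move=> xi _; rewrite /density mulrA.
move=> ->; congr (_ * _); apply: eq_Rintegral => u; rewrite inE => su.
by rewrite mulrA mulfV ?mul1r// lt_eqF// DP_lt0.
Qed.

Let dist (F : set V) u := inf [set `|u - y| | y in F].

Let dist_has_inf (F : set V) u : F !=set0 -> has_inf [set `|u - y| | y in F].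
Proof.
by move=> [y Fy]; split; [exists `|u - y|, y|exists 0 => _ [z _ <-]].
Qed.

Let dist_lip (F : set V) : F !=set0 -> forall u v, `|dist F u - dist F v| <= 1 * `|u - v|.
Proof.
move=> F0; suff H u v : dist F u - dist F v <= `|u - v|.
  by move=> u v; rewrite mul1r ler_norml H andbT lerNl opprB distrC H.
rewrite lerBlDr -lerBlDl; apply: lb_le_inf.
  by have [y Fy] := F0; exists `|v - y|, y.
move=> _ [y Fy <-]; rewrite lerBlDl.
apply: (@le_trans _ _ `|u - y|).
  by apply: ge_inf; [case: (dist_has_inf u F0)|exists y].
by rewrite -(subrKA v u (- y)) ler_normD.
Qed.

Let dist_ge0 (F : set V) u : F !=set0 -> 0 <= dist F u.
Proof.
move=> [y Fy]; apply: lb_le_inf; first by exists `|u - y|, y.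
by move=> _ [z _ <-].
Qed.

Let dist_in (F : set V) u : F u -> dist F u = 0.
Proof.
move=> Fu; apply/eqP; rewrite eq_le dist_ge0 ?andbT; last by exists u.
apply: ge_inf; first by exists 0 => _ [z _ <-].
by exists u => //; rewrite subrr normr0.
Qed.

Let dist_gt0 (F : set V) u : closed F -> F !=set0 -> ~ F u -> 0 < dist F u.
Proof.
move=> cF F0 nFu; rewrite lt_neqAle dist_ge0// andbT; apply/eqP => d0; apply: nFu.
apply: cF => B Bu.
have [e /= e0 eB] : exists2 e : R, 0 < e & forall y, `|u - y| < e -> B y.
  by move: Bu; rewrite -(@nbhs_nbhs_norm R V) => -[e /= e0 eB]; exists e.
have [_ [y Fy <-] ye] := inf_adherent e0 (dist_has_inf u F0).
by exists y; split => //; apply: eB; move: ye; rewrite -/(dist F u) -d0 add0r.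
Qed.

Lemma balanced_closed k (F : set V) :
  (forall g, {within sphere, continuous g} ->
    \int[lam]_(xi in X) (density xi * g (al xi)) =
    k * \int[mu]_(u in (sphere : set (Rn R n))) g u) ->
  closed F -> balanced k F.
Proof.
move=> Hk cF; rewrite /balanced.
(* The distance to the empty set is a default value of [inf], hence the separate case. *)
have [F0|nF0] := pselect (F !=set0); last first.
  have -> : F = set0 by apply/seteqP; split => // x Fx; exfalso; apply: nF0; exists x.
  by rewrite preimage_set0 !setI0 integral_set0 measure0 mule0.
(* Continuous functions bounded by 1 that converge pointwise to the indicator of the closed set [F];
   dominated convergence applies on both sides. *)
pose phi (j : nat) u := Num.max (1 - j%:R * dist F u) 0.
have cphi j : {within sphere, continuous (phi j)}.
  apply: continuous_subspaceT; apply: (lipschitz_continuous (k := j%:R)) => u v.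
  apply: le_trans (norm_pos_part_sub _ _) _.
  have -> : 1 - j%:R * dist F u - (1 - j%:R * dist F v) = j%:R * (dist F v - dist F u) by ring.
  rewrite normrM ger0_norm// ler_wpM2l//.
  by have := dist_lip F0 u v; rewrite mul1r [`|dist F u - _|]distrC.
have phi1 j u : `|phi j u| <= 1.
  rewrite /phi ger0_norm ?le_max ?lexx ?orbT// ge_max ler01 andbT.
  by rewrite gerBl mulr_ge0 ?dist_ge0.
have phi_cvg u (c : R) : c * phi j u @[j --> \oo] --> ((fun=> c) \_ F) u.
  rewrite /patch; case: ifPn; rewrite ?inE ?notin_setE => Fu.
    rewrite (_ : (fun j => _) = fun=> c); first exact: cvg_cst.
    by apply/funext => j; rewrite /phi dist_in// mulr0 subr0 max_l ?mulr1.
  have d0 := dist_gt0 cF F0 Fu.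
  apply: cvg_near_cst; near=> j.
  rewrite /phi max_r ?mulr0//; rewrite subr_le0 -ler_pdivrMr// div1r.
  by near: j; exact: nbhs_infty_ger.
have mF : measurable (F : set (Rn R n)) by exact: measurable_closed_Rn.
have mXF : measurable (X `&` al @^-1` F) by exact: measurable_radial_gauss.
have [B B0 HB] := density_bounded.
have L : \int[lam]_(xi in X) (density xi * phi j (al xi)) @[j --> \oo] -->
    \int[lam]_(xi in X `&` al @^-1` F) density xi.
  rewrite Rintegral_mkcondr; apply: (cvg_Rintegral_bounded mX Xfin (M := B)).
  - by move=> j; apply: measurable_funM; [exact: measurable_density|exact: measurable_comp_radial_gauss].
  - by move=> j xi [sx _]; rewrite normrM -[leRHS]mulr1 ler_pM// HB.
  - move=> xi [sx _]; have := phi_cvg (al xi) (density xi).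
    by rewrite /patch; congr (_ --> _).
have M : \int[mu]_(u in (sphere : set (Rn R n))) phi j u @[j --> \oo] -->
    fine (mu (sphere `&` F)).
  have -> : fine (mu (sphere `&` F)) = \int[mu]_(u in (sphere `&` F : set (Rn R n))) 1.
    by rewrite Rintegral_cst ?mul1r//; exact: measurableI.
  rewrite Rintegral_mkcondr; apply: (cvg_Rintegral_bounded mS (sph_measure_fin smu) (M := 1)).
  - by move=> j; exact: measurable_fun_within_continuous.
  - by [].
  - move=> u su; have := phi_cvg u 1; rewrite (_ : (fun j => 1 * phi j u) = phi ^~ u)//.
    by apply/funext => j; rewrite mul1r.
have e : \int[lam]_(xi in X `&` al @^-1` F) density xi = k * fine (mu (sphere `&` F)).
  apply: (cvg_unique _ L) => //.
  rewrite (_ : (fun j => _) = (fun j => k * \int[mu]_(u in (sphere : set (Rn R n))) phi j u)).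
    exact: cvgMr.
  by apply/funext => j; exact: Hk.
have f1 : (\int[lam]_(xi in X `&` al @^-1` F) (density xi)%:E)%E \is a fin_num.
  apply: integrable_fin_num => //; apply: (integrableS mX) => //.
  apply: (integrable_bounded_by mX Xfin (M := B)); first exact: measurable_density.
  by move=> xi [sx _]; exact: HB.
have f2 : mu (sphere `&` F) \is a fin_num.
  rewrite ge0_fin_numE//; apply: le_lt_trans (sph_measure_fin smu).
  by apply: le_measure; rewrite ?inE//; exact: measurableI.
by rewrite -(fineK f1) -(fineK f2) -EFinM -e.
Unshelve. all: by end_near. Qed.

Lemma balanced_setC k om : measurable om -> balanced k setT -> balanced k om -> balanced k (~` om).
Proof.
rewrite /balanced => mom bT bom.
have mA : measurable (X `&` al @^-1` om) by exact: measurable_radial_gauss.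
have mB : measurable (X `&` al @^-1` (~` om)).
  by apply: measurable_radial_gauss => //; exact: measurableC.
have f2 : mu (sphere `&` om) \is a fin_num.
  rewrite ge0_fin_numE//; apply: le_lt_trans (sph_measure_fin smu).
  by apply: le_measure; rewrite ?inE//; exact: measurableI.
have XE : (X `&` al @^-1` om) `|` (X `&` al @^-1` (~` om)) = X `&` al @^-1` setT.
  by rewrite -setIUr -preimage_setU setUv.
move: bT; rewrite -XE ge0_integral_setU//; last 3 first.
- rewrite XE; apply/measurable_EFinP; apply: (measurable_funS mX); first exact: subIsetl.
  exact: measurable_density.
- by move=> xi; rewrite XE => -[[sx _] _]; rewrite lee_fin density_ge0.
- by apply/disj_setPS => xi [[_ +] [_]].
rewrite bom setIT (measureDI _ mS mom) addrC.
have -> : sphere `\` om = sphere `&` ~` om by [].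
rewrite ge0_muleDr//.
move=> e; have f3 : (k%:E * mu (sphere `&` om))%E \is a fin_num by rewrite fin_numM.
have := congr1 (fun z => z - k%:E * mu (sphere `&` om))%E e.
by rewrite !addeK.
Qed.

Lemma balanced_bigcup k (F : (set (Rn R n))^nat) : 0 < k -> (forall i, measurable (F i)) ->
  trivIset setT F -> (forall i, balanced k (F i)) -> balanced k (\bigcup_i F i).
Proof.
rewrite /balanced => k0 mF tF bF; rewrite preimage_bigcup !setI_bigcupr.
have mA i : measurable (X `&` al @^-1` F i) by exact: measurable_radial_gauss.
rewrite ge0_integral_bigcup//; last 3 first.
- apply/measurable_EFinP; apply: (measurable_funS mX); last exact: measurable_density.
  by move=> xi [i _ []].
- by move=> xi [i _ [[sx _] _]]; rewrite lee_fin density_ge0.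
- move=> i j _ _ [xi [[_ Fi] [_ Fj]]]; apply: tF => //.
  by exists (al xi).
rewrite measure_semi_bigcup//; last 3 first.
- by move=> i; exact: measurableI.
- by move=> i j _ _ [u [[_ Fi] [_ Fj]]]; apply: tF => //; exists u.
- by apply: bigcup_measurable => i _; exact: measurableI.
rewrite -nneseriesZl//; apply: eq_eseriesr => i _; exact: bF.
Qed.

(** Open sets form a pi-system generating the Borel sets and are balanced as complements of closed
    ones; the pi-lambda theorem extends this to all Borel sets. *)
Lemma balanced_measurable : exists2 k : R, 0 < k &
  forall om : set (Rn R n), measurable om -> balanced k om.
Proof.
have [k k0 Hk] := density_test; exists k => // om mom.
have bT : balanced k setT by apply: balanced_closed => //; exact: closedT.
apply: (@dynkin_induction _ (Rn R n) (@open V) (balanced k)) => //.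
- exact: openI.
- move=> U oU; rewrite -[U]setCK; apply: balanced_setC => //.
    by apply: measurable_closed_Rn; exact: open_closedC.
  by apply: balanced_closed => //; exact: open_closedC.
- by move=> S mS' bS; exact: balanced_setC.
- by move=> F mF tF bF; exact: balanced_bigcup.
Qed.

(** * Identification with C_Theta and conclusion *)

Lemma C_Theta_integrandE xi : sphere xi ->
  (radial (wulff h) xi * dt G xi (radial (wulff h) xi)) /
  (radial (polar (wulff h)) (al xi) * dt Psi (al xi) (radial (polar (wulff h)) (al xi))) =
  density xi.
Proof.
move=> sx; rewrite (radial_wulff n0 hq sx) (radial_polar_wulff n0 hq); last exact: radial_gauss_sphere.
by rewrite /density [(q xi)^-1 * _]mulrC [(h _)^-1 * _]mulrC.
Qed.

(** The reverse Gauss image is not known to be measurable. Removing [N], allowed by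
    [integral_null_setD] without measurability, leaves the preimage of [om] under [al], as normals
    are unique there. *)
Lemma C_Theta_wulff om :
  C_Theta G Psi lam (wulff h) om = (\int[lam]_(xi in X `&` al @^-1` om) (density xi)%:E)%E.
Proof.
rewrite /C_Theta (integral_null_setD mN lamN); last first.
  by move=> xi [sx _]; rewrite C_Theta_integrandE// lee_fin density_ge0.
have -> : rev_radial_gauss (wulff h) om `\` N = X `&` al @^-1` om.
  apply/seteqP; split => [xi [[sx [u [Ku ou]]] Nxi]|xi [[sx Nxi] oa]]; split => //=.
    suff <- : u = al xi by [].
    apply: (uniqN sx Nxi Ku).
    exact/(radial_gauss_wulffE n0 hq _ sx)/(radial_gauss_wulffP n0 hq).
  split => //; exists (al xi); split => //.
  exact/(radial_gauss_wulffE n0 hq _ sx)/(radial_gauss_wulffP n0 hq).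
apply: eq_integral => xi; rewrite inE => -[[sx _] _].
by rewrite C_Theta_integrandE.
Qed.

End Stationarity.

Theorem theorem5p4 (R : realType) (n : nat) (hn : (2 <= n)%N)
  (G Psi : 'rV[R]_n -> R -> R)
  (lam mu : {measure set Rn R n -> \bar R}) :
  classM lam -> not_conc_hemisphere lam ->
  sph_measure mu -> not_conc_hemisphere mu ->
  ((classCd Psi /\ (forall xi, sphere xi -> Psi xi t @[t --> 0^'+] --> +oo)
    /\ classGd G) \/
   (classCd G /\ (forall xi, sphere xi -> G xi t @[t --> 0^'+] --> +oo)
    /\ classGd Psi)) ->
  exists K : set 'rV[R]_n, convex_body_o K /\
    (0 < C_Theta G Psi lam K sphere < +oo)%E /\
    forall omega : set (Rn R n), measurable omega -> omega `<=` sphere ->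
      fine (mu omega) / fine (mu sphere) =
      fine (C_Theta G Psi lam K omega) / fine (C_Theta G Psi lam K sphere).
Proof.
move=> Mlam nlam smu nmu hyp; have n0 : (0 < n)%N by exact: leq_trans hn.
have slam := Mlam.1; have mS := @measurable_sphere R n.
(* Cases (a) and (b) differ only in which integrand is positive; the remaining conditions are
   symmetric in G and Psi. *)
have [CG [CP [bG [bP pos]]]] : classCd G /\ classCd Psi /\
    (forall xi, sphere xi -> G xi t @[t --> 0^'+] --> +oo) /\
    (forall xi, sphere xi -> Psi xi t @[t --> 0^'+] --> +oo) /\
    ((forall u t, sphere u -> 0 < t -> 0 < G u t) \/
     (forall u t, sphere u -> 0 < t -> 0 < Psi u t)).
  case: hyp => [[CP [bP [cG [pG [dG [bG _]]]]]]|[CG [bG [cP [pP [dP [bP _]]]]]]].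
    by do ![split => //]; left.
  by do ![split => //]; right.
have [h [q [hq ch cq Hmin]]] := exists_minimal_pair n0 slam nlam smu nmu CG bG CP bP pos.
have [N [mN lamN uniqN]] := unique_normal_ae n0 hq cq Mlam.
have [k k0 Hk] := balanced_measurable n0 CG CP slam smu hq ch cq mN lamN uniqN Hmin.
have CE (om : set (Rn R n)) : measurable om -> om `<=` sphere ->
    C_Theta G Psi lam (wulff h) om = (k%:E * mu om)%E.
  move=> mom oS; rewrite (C_Theta_wulff n0 CG CP hq mN lamN uniqN) Hk//.
  by rewrite setIC; congr (_ * mu _)%E; exact: setIidl.
have muS : mu (sphere : set (Rn R n)) \is a fin_num.
  by rewrite ge0_fin_numE//; exact: sph_measure_fin.
have muS0 := sph_measure_gt0 smu.
exists (wulff h); split; first by apply: convex_body_wulff => //; case: hq.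
split.
  rewrite CE// -(fineK muS) -EFinM lte_fin ltry andbT.
  exact: mulr_gt0.
move=> om mom oS; rewrite !CE//.
have muo : mu om \is a fin_num.
  rewrite ge0_fin_numE//; apply: le_lt_trans (sph_measure_fin smu).
  by apply: le_measure; rewrite ?inE.
by rewrite !fineM//= -mulf_div divff ?mul1r// gt_eqF.
Qed.
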